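(* Let $(G,c)$ be an infinite network, and let $S$ and $S'$ be the spaces of test functions and distributions corresponding to the orthonormal basis $\{\varepsilon_n\}_{n\in\mathbb N}$ of $\mathcal H_{\mathcal E}$ obtained by applying Gram-Schmidt to the energy kernel $\{v_{x_n}\}_{n\in\mathbb N}$. Then the inclusion mapping $S\hookrightarrow\mathcal H_{\mathcal E}$ is nuclear, and so $S\subset\mathcal H_{\mathcal E}\subset S'$ is a Gel'fand triple.
   Context: Network: a vertex set $G$ with conductances $c_{xy}=c_{yx}\in[0,\infty)$, $c_{xx}=0$; $x\sim y$ iff $c_{xy}>0$; the resulting graph is connected, and $c(x):=\sum_{y\sim x}c_{xy}<\infty$ for every $x$. Fix a vertex $o$. All functions are real-valued. Energy: $\mathcal E(u,v)=\frac12\sum_{x,y}c_{xy}(u(x)-u(y))(v(x)-v(y))$. $\mathcal H_{\mathcal E}$ is the Hilbert space of functions on $G$ with $\mathcal E(u,u)<\infty$ modulo constants, with inner product $\langle u,v\rangle_{\mathcal E}=\mathcal E(u,v)$. The energy kernel $v_x\in\mathcal H_{\mathcal E}$ is the unique element with $\langle v_x,u\rangle_{\mathcal E}=u(x)-u(o)$ for all $u$. Fix an enumeration $x_1,x_2,\dots$ of $G\setminus\{o\}$ and let $\varepsilon_1,\varepsilon_2,\dots$ be the orthonormal basis of $\mathcal H_{\mathcal E}$ obtained from $v_{x_1},v_{x_2},\dots$ by Gram-Schmidt. Define $S=\{s=\sum_n s_n\varepsilon_n:\ \forall p\in\mathbb N\ \exists C>0,\ |s_n|\le C n^{-p}\ \forall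 n\}$, with the Fréchet topology of the seminorms $\|s\|_p=(\sum_n n^p|s_n|^2)^{1/2}$, $p\in\mathbb N$, and $S'=\{\xi=\sum_n\xi_n\varepsilon_n \text{ (formal series)}:\ \exists p\in\mathbb N,\ C>0,\ |\xi_n|\le Cn^p\ \forall n\}$, acting on $S$ by $\langle s,\xi\rangle=\sum_n s_n\xi_n$. Gel'fand triple: $S$ is a dense subspace of $\mathcal H_{\mathcal E}$ carrying a Fréchet topology strictly finer than the norm topology, with continuous (nuclear) inclusion into $\mathcal H_{\mathcal E}$; $S'$ is the dual of $S$ for this topology; and $\mathcal H_{\mathcal E}\subset S'$ via $v\mapsto\langle\cdot,v\rangle_{\mathcal E}$. *)

(* Defs.v *)
From HB Require Import structures.
From mathcomp Require Import all_boot all_order all_algebra.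
From mathcomp Require Import all_classical all_reals all_analysis.
From mathcomp Require Import ring lra.
Set Implicit Arguments.
Unset Strict Implicit.
Unset Printing Implicit Defensive.

Import Order.TTheory GRing.Theory Num.Theory numFieldNormedType.Exports.

Local Open Scope classical_set_scope.
Local Open Scope ring_scope.

Section FamilySum.
Variables (R : realType) (T : choiceType).
Implicit Types f g : T -> R.

Definition fsummable f := summable [set: T] (EFin \o f).

(* Unordered sum of a real-valued family; meaningful when [fsummable f]. *)
Definition family_sum f : R :=
  fine (\esum_(i in [set: T]) (EFin \o f)^\+ i -
        \esum_(i in [set: T]) (EFin \o f)^\- i)%E.

Lemma le_fsummable f g :
  (forall i, `|f i| <= g i) -> fsummable g -> fsummable f.
Proof.
move=> fg; apply: le_lt_trans; apply: le_esum => i _ /=.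
by rewrite lee_fin (le_trans (fg i))// ler_norm.
Qed.

Lemma fsummableD f g : fsummable f -> fsummable g -> fsummable (f \+ g).
Proof. by move=> sf sg; have := summableD sf sg. Qed.

Lemma esum_scale f a : 0 <= a -> (forall i, 0 <= f i) ->
  (\esum_(i in [set: T]) (a * f i)%:E = a%:E * \esum_(i in [set: T]) (f i)%:E)%E.
Proof.
move=> a0 f0; rewrite /esum -ereal_supZl//; last first.
  by apply/set0P; exists 0%E; exists set0; [exact: fsets_set0|rewrite fsbig_set0].
congr ereal_sup; rewrite image_comp; apply: eq_imagel => X [finX _] /=.
by rewrite ge0_mule_fsumr// => i; rewrite lee_fin.
Qed.

Lemma fsummableZ a f : fsummable f -> fsummable (a \*o f).
Proof.
move=> sf; rewrite /fsummable /summable /=.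
under eq_esum do rewrite normrM.
rewrite esum_scale//.
move: sf; rewrite /fsummable /summable /= => sf.
by apply: lte_mul_pinfty.
Qed.

Lemma family_sumB f g : (forall i, 0 <= f i) -> (forall i, 0 <= g i) ->
  fsummable f -> fsummable g ->
  family_sum (f \- g) = fine (\esum_(i in [set: T]) (f i)%:E) -
                        fine (\esum_(i in [set: T]) (g i)%:E).
Proof.
move=> f0 g0 sf sg; rewrite /family_sum.
have := esumB sf sg (fun i _ => f0 i) (fun i _ => g0 i).
have -> : ((EFin \o f) \- (EFin \o g))%E = EFin \o (f \- g) by [].
move=> ->; rewrite fineB//.
- move: sf; rewrite /fsummable summableE => /=; congr (_ \is a _).
  by apply: eq_esum => i _ /=; rewrite ger0_norm.
- move: sg; rewrite /fsummable summableE => /=; congr (_ \is a _).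
  by apply: eq_esum => i _ /=; rewrite ger0_norm.
Qed.

Let pos f i := Num.max (f i) 0.
Let neg f i := Num.max (- f i) 0.

Let pos_ge0 f i : 0 <= pos f i. Proof. by rewrite /pos le_max lexx orbT. Qed.
Let neg_ge0 f i : 0 <= neg f i. Proof. by rewrite /neg le_max lexx orbT. Qed.
Let posneg f : pos f \- neg f = f.
Proof.
apply/funext => i; rewrite /= /pos /neg.
case: (leP (f i) 0) => fi; case: (leP (- f i) 0) => nfi; rewrite ?subr0 ?add0r ?opprK //.
  by move: nfi; rewrite oppr_le0 => nfi; apply/eqP; rewrite eq_sym eq_le fi.
by move: nfi; rewrite oppr_gt0 => /(lt_trans fi); rewrite ltxx.
Qed.
Let spos f : fsummable f -> fsummable (pos f).
Proof.
move=> sf; apply: (@le_fsummable _ (fun i => `|f i|)); last first.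
  by move: sf; rewrite /fsummable /summable /=; under [in X in _ -> X]eq_esum do rewrite normr_id.
by move=> i; rewrite ger0_norm// /pos ge_max ler_norm normr_ge0.
Qed.
Let sneg f : fsummable f -> fsummable (neg f).
Proof.
move=> sf; apply: (@le_fsummable _ (fun i => `|f i|)); last first.
  by move: sf; rewrite /fsummable /summable /=; under [in X in _ -> X]eq_esum do rewrite normr_id.
by move=> i; rewrite ger0_norm// /neg ge_max -[`|f i|]normrN ler_norm normr_ge0.
Qed.

Let sfin f : (forall i, 0 <= f i) -> fsummable f ->
  (\esum_(i in [set: T]) (f i)%:E)%E \is a fin_num.
Proof.
move=> f0; rewrite /fsummable summableE => /=; congr (_ \is a _).
by apply: eq_esum => i _ /=; rewrite ger0_norm.
Qed.

Lemma family_sumD f g : fsummable f -> fsummable g ->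
  family_sum (f \+ g) = family_sum f + family_sum g.
Proof.
move=> sf sg; rewrite -[in LHS](posneg f) -[in LHS](posneg g).
have -> : (pos f \- neg f) \+ (pos g \- neg g) =
          (pos f \+ pos g) \- (neg f \+ neg g).
  by apply/funext => i /=; rewrite opprD addrACA.
rewrite family_sumB; last first.
- by apply: fsummableD; exact: sneg.
- by apply: fsummableD; exact: spos.
- by move=> i; rewrite addr_ge0.
- by move=> i; rewrite addr_ge0.
rewrite -[in RHS](posneg f) -[in RHS](posneg g).
rewrite !family_sumB//; [|exact: spos|exact: sneg|exact: spos|exact: sneg].
have E (h k : T -> R) : (forall i, 0 <= h i) -> (forall i, 0 <= k i) ->
    fsummable h -> fsummable k ->
    fine (\esum_(i in [set: T]) (h i + k i)%:E) =
    fine (\esum_(i in [set: T]) (h i)%:E) + fine (\esum_(i in [set: T]) (k i)%:E).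
  move=> h0 k0 sh sk; under eq_esum do rewrite EFinD.
  rewrite esumD//; last 2 first.
  - by move=> i _; rewrite lee_fin.
  - by move=> i _; rewrite lee_fin.
  by rewrite fineD// sfin.
rewrite /= !E//; [|exact: sneg|exact: sneg|exact: spos|exact: spos].
by rewrite opprD addrACA.
Qed.

Lemma ge0_family_sum f : (forall i, 0 <= f i) -> fsummable f ->
  family_sum f = fine (\esum_(i in [set: T]) (f i)%:E).
Proof.
move=> f0 sf; have fE : f \- (fun=> 0) = f.
  by apply/funext => i /=; rewrite subr0.
rewrite -[in LHS]fE family_sumB//; last first.
  by rewrite /fsummable /summable esum1//= => i _; rewrite normr0.
by rewrite [X in _ - fine X]esum1// subr0.
Qed.

Lemma family_sumZ a f : fsummable f -> family_sum (a \*o f) = a * family_sum f.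
Proof.
move=> sf.
have pZ b h : 0 <= b -> (forall i, 0 <= h i) -> fsummable h ->
    fine (\esum_(i in [set: T]) (b * h i)%:E) =
    b * fine (\esum_(i in [set: T]) (h i)%:E).
  by move=> b0 h0 sh; rewrite esum_scale// fineM// sfin.
rewrite -[in LHS](posneg f) -[in RHS](posneg f) (family_sumB (pos_ge0 f) (neg_ge0 f) (spos sf) (sneg sf)).
have [a0|/ltW a0] := leP 0 a.
  have -> : a \*o (pos f \- neg f) = (a \*o pos f) \- (a \*o neg f).
    by apply/funext => i /=; rewrite mulrBr.
  rewrite family_sumB; [|by move=> i /=; rewrite mulr_ge0|by move=> i /=; rewrite mulr_ge0|
    by apply/fsummableZ/spos|by apply/fsummableZ/sneg].
  by rewrite /= !pZ//; [rewrite mulrBr|exact: sneg|exact: spos].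
have na0 : 0 <= - a by rewrite oppr_ge0.
have -> : a \*o (pos f \- neg f) = ((- a) \*o neg f) \- ((- a) \*o pos f).
  by apply/funext => i /=; rewrite !mulNr opprK mulrBr addrC.
rewrite family_sumB; [|by move=> i /=; rewrite mulr_ge0|by move=> i /=; rewrite mulr_ge0|
  by apply/fsummableZ/sneg|by apply/fsummableZ/spos].
rewrite /= !pZ//; [|exact: spos|exact: sneg].
by rewrite !mulNr opprK mulrBr addrC.
Qed.

Lemma family_sum_ge0 f : (forall i, 0 <= f i) -> fsummable f -> 0 <= family_sum f.
Proof.
move=> f0 sf; rewrite ge0_family_sum//; apply: fine_ge0.
by apply: esum_ge0 => i _; rewrite lee_fin.
Qed.

Lemma family_sum_eq0 f : (forall i, 0 <= f i) -> fsummable f ->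
  family_sum f = 0 -> forall i, f i = 0.
Proof.
move=> f0 sf; rewrite ge0_family_sum// => /eqP; rewrite fine_eq0 ?sfin// => /eqP E i.
apply/eqP; rewrite eq_le f0 andbT.
have : ((f i)%:E <= \esum_(i in [set: T]) (f i)%:E)%E.
  apply: esum_ge; exists [set i]; last by rewrite fsbig_set1.
  by split=> //; exact: finite_set1.
by rewrite E lee_fin.
Qed.

End FamilySum.

Section SemiInner.
Variables (R : realType) (U : lmodType R) (B : U -> U -> R).
Hypothesis Bsym : forall u v, B u v = B v u.
Hypothesis Blin : forall a u v w, B (a *: u + v) w = a * B u w + B v w.
Hypothesis Bge0 : forall u, 0 <= B u u.

Let BDl u v w : B (u + v) w = B u w + B v w.
Proof. by have := Blin 1 u v w; rewrite scale1r mul1r. Qed.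
Let B0l w : B 0 w = 0.
Proof. by have := BDl 0 0 w; rewrite addr0 -[in X in X = _](addr0 (B 0 w)) => /addrI. Qed.
Let BZl a u w : B (a *: u) w = a * B u w.
Proof. by have := Blin a u 0 w; rewrite B0l !addr0. Qed.

Lemma semi_inner_CS u v : B u v ^+ 2 <= B u u * B v v.
Proof.
have H t : 0 <= B u u - 2 * t * B u v + t ^+ 2 * B v v.
  have := Bge0 (u + (- t) *: v).
  rewrite BDl BZl (Bsym u) (Bsym v) !BDl !BZl (Bsym v u).
  by congr (0 <= _); ring.
have [v0|vN0] := eqVneq (B v v) 0.
  rewrite v0 mulr0; have [->|uv0] := eqVneq (B u v) 0; first by rewrite expr0n.
  have := H ((B u u + 1) / (2 * B u v)); rewrite v0 mulr0 addr0.
  have -> : B u u - 2 * ((B u u + 1) / (2 * B u v)) * B u v = - 1 by field.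
  by rewrite oppr_ge0 ler10.
have vgt0 : 0 < B v v by rewrite lt_def vN0 Bge0.
have := H (B u v / B v v).
have -> : B u u - 2 * (B u v / B v v) * B u v + (B u v / B v v) ^+ 2 * B v v =
          B u u - B u v ^+ 2 / B v v by field.
by rewrite subr_ge0 ler_pdivrMr.
Qed.

Lemma semi_inner_triangle u v :
  Num.sqrt (B (u + v) (u + v)) <= Num.sqrt (B u u) + Num.sqrt (B v v).
Proof.
rewrite -(ler_pXn2r (n := 2))// ?nnegrE ?addr_ge0 ?sqrtr_ge0//.
rewrite sqrrD !sqr_sqrtr// BDl (Bsym u) (Bsym v (u + v)) !BDl (Bsym v u).
rewrite -[X in X <= _]/(B u u + B u v + (B u v + B v v)).
have -> : B u u + B u v + (B u v + B v v) = B u u + B u v *+ 2 + B v v by ring.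
rewrite lerD2r lerD2l lerMn2r/= -sqrtrM//.
by rewrite (le_trans (ler_norm _))// -sqrtr_sqr ler_wsqrtr// semi_inner_CS.
Qed.

Lemma semi_inner_homog a u :
  Num.sqrt (B (a *: u) (a *: u)) = `|a| * Num.sqrt (B u u).
Proof. by rewrite BZl Bsym BZl mulrA -expr2 sqrtrM ?sqr_ge0// sqrtr_sqr. Qed.

End SemiInner.

(* Sums over all y stand for sums over y ~ x: the other terms vanish. *)
Record network (R : realType) (V : choiceType) := Network {
  conductance :> V -> V -> R;
  conductance_ge0 : forall x y, 0 <= conductance x y;
  conductance_sym : forall x y, conductance x y = conductance y x;
  conductance_diag : forall x, conductance x x = 0;
  conductance_connected : forall x y, exists2 p : seq V,
    path (fun a b => 0 < conductance a b) x p & last x p = y;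
  conductance_summable : forall x,
    (\esum_(y in [set: V]) (conductance x y)%:E < +oo)%E
}.

Section Energy.
Variables (R : realType) (V : choiceType) (N : network R V).

Definition energy (u v : V -> R) : R :=
  2^-1 * family_sum (fun e : V * V =>
    N e.1 e.2 * (u e.1 - u e.2) * (v e.1 - v e.2)).

Definition finite_energy_pred : {pred V -> R} := fun u =>
  (\esum_(e in [set: V * V]) (N e.1 e.2 * (u e.1 - u e.2) ^+ 2)%:E < +oo)%E.

Let term_ge0 (u : V -> R) (e : V * V) : 0 <= N e.1 e.2 * (u e.1 - u e.2) ^+ 2.
Proof. by rewrite mulr_ge0 ?sqr_ge0//; exact: conductance_ge0. Qed.

Lemma finite_energyP u : u \in finite_energy_pred <->
  fsummable (fun e : V * V => N e.1 e.2 * (u e.1 - u e.2) ^+ 2).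
Proof.
rewrite /fsummable /summable (@eq_esum _ _ _ _
  (fun e => (N e.1 e.2 * (u e.1 - u e.2) ^+ 2)%:E)).
  by split=> H; exact: H.
by move=> e _ /=; rewrite ger0_norm.
Qed.

Lemma energy_summable u v : u \in finite_energy_pred -> v \in finite_energy_pred ->
  fsummable (fun e : V * V => N e.1 e.2 * (u e.1 - u e.2) * (v e.1 - v e.2)).
Proof.
move=> /finite_energyP su /finite_energyP sv.
apply: le_fsummable (fsummableD su sv) => e /=.
rewrite !normrM (ger0_norm (conductance_ge0 N _ _)) -mulrA -mulrDr.
apply: ler_wpM2l; first exact: conductance_ge0.
rewrite -(real_normK (num_real (u e.1 - u e.2))).
rewrite -(real_normK (num_real (v e.1 - v e.2))).
have := normr_ge0 (u e.1 - u e.2); have := normr_ge0 (v e.1 - v e.2).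
by move: `|_| `|_| => a b a0 b0; nra.
Qed.

Fact finite_energy_submod : subsemimod_closed finite_energy_pred.
Proof.
have f0 : (0 : V -> R) \in finite_energy_pred.
  apply/finite_energyP; rewrite /fsummable /summable esum1//= => e _.
  by rewrite subrr expr0n mulr0 normr0.
have fD (u v : V -> R) : u \in finite_energy_pred -> v \in finite_energy_pred ->
    u + v \in finite_energy_pred.
  move=> /finite_energyP su /finite_energyP sv; apply/finite_energyP.
  apply: le_fsummable (fsummableZ 2 (fsummableD su sv)) => e /=.
  rewrite ger0_norm//.
  have -> : forall n a b : R, 2 * (n * a + n * b) = n * (2 * (a + b)).
    by move=> n a b; ring.
  apply: ler_wpM2l; first exact: conductance_ge0.
  rewrite -[(u + v) e.1]/(u e.1 + v e.1) -[(u + v) e.2]/(u e.2 + v e.2).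
  rewrite -subr_ge0; set d := (X in 0 <= X).
  have -> : d = ((u e.1 - u e.2) - (v e.1 - v e.2)) ^+ 2 by rewrite /d; ring.
  exact: sqr_ge0.
split; first by split.
move=> a u /finite_energyP su; apply/finite_energyP.
apply: le_fsummable (fsummableZ (a ^+ 2) su) => e /=.
rewrite ger0_norm// -[(a *: u) e.1]/(a * u e.1) -[(a *: u) e.2]/(a * u e.2).
by rewrite -mulrBr exprMn mulrCA.
Qed.

HB.instance Definition _ :=
  GRing.isSubmodClosed.Build R (V -> R) finite_energy_pred finite_energy_submod.

Record finite_energy := FiniteEnergy {
  finite_energy_fun :> V -> R;
  finite_energy_funP : finite_energy_fun \in finite_energy_pred }.
HB.instance Definition _ := [isSub for finite_energy_fun].
HB.instance Definition _ := [Choice of finite_energy by <:].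
HB.instance Definition _ := [SubChoice_isSubLmodule of finite_energy by <:].

(* The energy space is the quotient of the finite-energy functions by the
   constants. *)
Definition constant_pred : {pred finite_energy} := fun u =>
  `[< exists a, forall x, u x = a >].

Fact constant_zmod : zmod_closed constant_pred.
Proof.
split; first by apply/asboolP; exists 0 => x.
move=> u v /asboolP[a ua] /asboolP[b vb]; apply/asboolP.
by exists (a - b) => x; rewrite -[LHS]/(u x - v x) ua vb.
Qed.
HB.instance Definition _ := GRing.isZmodClosed.Build finite_energy constant_pred constant_zmod.

Definition energy_space := Quotient.quot constant_pred.
HB.instance Definition _ := GRing.Zmodule.on energy_space.
HB.instance Definition _ := EqQuotient.on energy_space.

Definition energy_class (u : finite_energy) : energy_space := \pi_energy_space%qT u.

(* u(x) - u(y), which does not depend on the representative u of h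
   ([incrementE]). *)
Definition increment (h : energy_space) (x y : V) : R :=
  (repr h : finite_energy) x - (repr h : finite_energy) y.

Lemma energy_class_eq (u v : finite_energy) :
  energy_class u = energy_class v <-> exists a, forall x, u x - v x = a.
Proof.
have : (u - v \in constant_pred) = (energy_class u == energy_class v).
  by rewrite (Quotient.idealrBE constant_pred).
move=> E; split=> [/eqP|[a H]].
  by rewrite -E => /asboolP[a H]; exists a => x; rewrite -(H x).
by apply/eqP; rewrite -E; apply/asboolP; exists a => x; rewrite -[RHS](H x).
Qed.

Lemma energy_classK h : energy_class (repr h) = h.
Proof. exact: reprK. Qed.

Lemma incrementE u x y : increment (energy_class u) x y = u x - u y.
Proof.
have [a H] := (energy_class_eq (repr (energy_class u)) u).1 (energy_classK _).
rewrite /increment; have := H x; have := H y; lra.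
Qed.

Lemma energy_classD u v : energy_class (u + v) = energy_class u + energy_class v.
Proof. exact: raddfD. Qed.

Definition energy_scale (a : R) (h : energy_space) : energy_space :=
  energy_class (a *: repr h).

Lemma energy_classZ a u : energy_scale a (energy_class u) = energy_class (a *: u).
Proof.
rewrite /energy_scale; apply/energy_class_eq.
have [b H] := (energy_class_eq (repr (energy_class u)) u).1 (energy_classK _).
by exists (a * b) => x; rewrite -(H x) mulrBr.
Qed.

Fact energy_scaleA a b h : energy_scale a (energy_scale b h) = energy_scale (a * b) h.
Proof. by rewrite -(energy_classK h) !energy_classZ scalerA. Qed.
Fact energy_scale1 : left_id 1 energy_scale.
Proof. by move=> h; rewrite -(energy_classK h) !energy_classZ scale1r. Qed.
Fact energy_scaleDr : right_distributive energy_scale +%R.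
Proof.
move=> a h k; rewrite -(energy_classK h) -(energy_classK k).
by rewrite -energy_classD !energy_classZ -energy_classD scalerDr.
Qed.
Fact energy_scaleDl h : {morph energy_scale^~ h : a b / a + b}.
Proof.
by move=> a b; rewrite -(energy_classK h) !energy_classZ -energy_classD scalerDl.
Qed.
HB.instance Definition _ := GRing.Zmodule_isLmodule.Build R energy_space
  energy_scaleA energy_scale1 energy_scaleDr energy_scaleDl.

Definition energy_inner (h k : energy_space) : R := energy (repr h) (repr k).

Lemma energy_innerE u v : energy_inner (energy_class u) (energy_class v) = energy u v.
Proof.
rewrite /energy_inner /energy; congr (_ * family_sum _); apply/funext => e.
by rewrite -!/(increment _ _ _) !incrementE.
Qed.

Fact energy_inner_sym h k : energy_inner h k = energy_inner k h.
Proof.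
by rewrite /energy_inner /energy; congr (_ * family_sum _); apply/funext => e; ring.
Qed.

Fact energy_inner_linear a h k l :
  energy_inner (a *: h + k) l = a * energy_inner h l + energy_inner k l.
Proof.
rewrite -(energy_classK h) -(energy_classK k) -(energy_classK l).
rewrite [a *: _]energy_classZ -energy_classD !energy_innerE.
move: (repr h) (repr k) (repr l) => u v w; rewrite /energy mulrCA -mulrDr.
have P (z : finite_energy) : (z : V -> R) \in finite_energy_pred by exact: finite_energy_funP.
rewrite -[a * family_sum _]family_sumZ; last exact: energy_summable.
rewrite -family_sumD; last 2 first.
- by apply: fsummableZ; exact: energy_summable.
- exact: energy_summable.
congr (_ * family_sum _); apply/funext => e /=.
have vE x : (a *: (u : V -> R) + (v : V -> R)) x = a * u x + v x by [].
by rewrite !vE; ring.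
Qed.

Fact energy_inner_ge0 h : 0 <= energy_inner h h.
Proof.
apply: mulr_ge0; first by rewrite invr_ge0.
apply: family_sum_ge0; last by apply: energy_summable; exact: finite_energy_funP.
by move=> e; rewrite -mulrA -expr2.
Qed.

Fact energy_inner_eq0 h : energy_inner h h = 0 -> h = 0.
Proof.
move=> /eqP; rewrite mulf_eq0 invr_eq0 pnatr_eq0/= => /eqP h0.
have edge x y : 0 < N x y -> (repr h : finite_energy) x = (repr h : finite_energy) y.
  move=> cxy; apply/eqP; rewrite -subr_eq0 -sqrf_eq0.
  have : N x y * ((repr h : finite_energy) x - (repr h : finite_energy) y) ^+ 2 = 0.
    rewrite expr2 mulrA.
    apply: (family_sum_eq0 _ _ h0 (x, y)).
      by move=> e; rewrite -mulrA -expr2.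
    by apply: energy_summable; exact: finite_energy_funP.
  by move/eqP; rewrite mulf_eq0 gt_eqF.
have const x y : (repr h : finite_energy) x = (repr h : finite_energy) y.
  have [p + <-] := conductance_connected N x y.
  by elim: p x => //= z p IH x /andP[/edge-> /IH].
rewrite -(energy_classK h) -[RHS](_ : energy_class 0 = _); last exact: raddf0.
apply/energy_class_eq.
have [[x _]|E] := pselect (exists x : V, True).
  by exists (repr h x) => y; rewrite subr0; exact: const.
by exists 0 => y; exfalso; apply: E; exists y.
Qed.

Fact energy_inner_additivel k : zmod_morphism (energy_inner ^~ k).
Proof.
move=> h h'; rewrite addrC -scaleN1r energy_inner_linear mulN1r.
by rewrite addrC.
Qed.
Fact energy_inner_additiver h : zmod_morphism (energy_inner h).
Proof.
by move=> k k'; rewrite !(energy_inner_sym h) energy_inner_additivel.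
Qed.
Fact energy_inner_scalel k : scalable_for *%R (energy_inner ^~ k).
Proof.
move=> a h; have := energy_inner_linear a h 0 k; rewrite addr0 => ->.
by rewrite -[0 : energy_space](subrr h) energy_inner_additivel subrr addr0.
Qed.
Fact energy_inner_scaler h : scalable_for (idfun \; *%R) (energy_inner h).
Proof. by move=> a k; rewrite energy_inner_sym energy_inner_scalel energy_inner_sym. Qed.

HB.instance Definition _ := isBilinear.Build R energy_space energy_space R
  *%R (idfun \; *%R) energy_inner energy_inner_additivel energy_inner_additiver
  energy_inner_scalel energy_inner_scaler.

Fact energy_inner_herm h k : energy_inner h k = (-1) ^+ false * idfun (energy_inner k h).
Proof. by rewrite expr0 mul1r energy_inner_sym. Qed.
HB.instance Definition _ := isHermitianSesquilinear.Build R energy_space false idfun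
  energy_inner energy_inner_herm.

Fact energy_inner_gt0 h : h != 0 -> 0 < energy_inner h h.
Proof.
move=> h0; rewrite lt_def energy_inner_ge0 andbT.
by apply: contra h0 => /eqP/energy_inner_eq0 ->.
Qed.
HB.instance Definition _ := isDotProduct.Build R energy_space energy_inner energy_inner_gt0.

Definition energy_norm (h : energy_space) : R := Num.sqrt (energy_inner h h).

Fact energy_normD h k : energy_norm (h + k) <= energy_norm h + energy_norm k.
Proof.
apply: semi_inner_triangle; [exact: energy_inner_sym|exact: energy_inner_linear|
  exact: energy_inner_ge0].
Qed.
Fact energy_normZ a h : energy_norm (a *: h) = `|a| * energy_norm h.
Proof. by apply: semi_inner_homog; [exact: energy_inner_sym|exact: energy_inner_linear]. Qed.
Fact energy_norm0_eq0 h : energy_norm h = 0 -> h = 0.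
Proof.
move/eqP; rewrite sqrtr_eq0 => h0; apply: energy_inner_eq0; apply/eqP.
by rewrite eq_le h0 energy_inner_ge0.
Qed.
HB.instance Definition _ := Lmodule_isNormed.Build R energy_space
  energy_normD energy_normZ energy_norm0_eq0.

End Energy.

Section Seminorms.
Variables (R : realType) (E : lmodType R).

Definition is_seminorm (q : E -> R) :=
  (forall x y, q (x + y) <= q x + q y) /\ (forall a x, q (a *: x) = `|a| * q x).

(* Neighbourhood filter of x in the topology generated by the q p. *)
Definition seminorm_nbhs (q : nat -> E -> R) (x : E) : set_system E :=
  [set U | exists n e, 0 < e /\
    [set y | forall p, (p <= n)%N -> q p (y - x) < e] `<=` U].

Section OneSeminorm.
Variable q : E -> R.
Hypothesis hq : is_seminorm q.

Lemma seminorm0 : q 0 = 0.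
Proof. by have := hq.2 0 0; rewrite scaler0 normr0 mul0r. Qed.

Lemma seminormN x : q (- x) = q x.
Proof. by rewrite -scaleN1r hq.2 normrN1 mul1r. Qed.

Lemma seminorm_ge0 x : 0 <= q x.
Proof.
have := hq.1 x (- x); rewrite subrr seminorm0 seminormN.
by rewrite -mulr2n pmulrn_lge0.
Qed.

Lemma seminorm_dist x y z : q (x - z) <= q (x - y) + q (y - z).
Proof. by have := hq.1 (x - y) (y - z); rewrite addrA subrK. Qed.
End OneSeminorm.

Variable q : nat -> E -> R.
Hypothesis hq : forall p, is_seminorm (q p).

Lemma seminorm_nbhs_filter x : ProperFilter (seminorm_nbhs q x).
Proof.
split.
  move=> [n [e [e0 /(_ x)]]]; apply => p _ /=.
  by rewrite subrr seminorm0.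
split.
- by exists 0%N, 1.
- move=> U W [n [e [e0 nU]]] [m [d [d0 mW]]].
  exists (maxn n m), (Num.min e d); split; first by rewrite lt_min e0.
  move=> y H; split; [apply: nU|apply: mW] => p pn.
    by have := H p (leq_trans pn (leq_maxl _ _)); rewrite lt_min => /andP[].
  by have := H p (leq_trans pn (leq_maxr _ _)); rewrite lt_min => /andP[].
- by move=> U W UW [n [e [e0 nU]]]; exists n, e; split=> // y /nU/UW.
Qed.

Lemma seminorm_nbhs_singleton x U : seminorm_nbhs q x U -> U x.
Proof. by move=> [n [e [e0]]]; apply => p _ /=; rewrite subrr seminorm0. Qed.

Lemma seminorm_nbhs_nbhs x U :
  seminorm_nbhs q x U -> seminorm_nbhs q x (seminorm_nbhs q ^~ U).
Proof.
move=> [n [e [e0 nU]]]; exists n, (e / 2); split; first by rewrite divr_gt0.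
move=> y H; exists n, (e / 2); split; first by rewrite divr_gt0.
move=> z K; apply: nU => p pn /=.
rewrite (le_lt_trans (seminorm_dist (hq p) z y x))// [ltRHS]splitr.
by rewrite ltrD ?(H _ pn) ?(K _ pn).
Qed.

End Seminorms.

HB.factory Record Lmodule_isSeminormed (R : realType) E & GRing.Lmodule R E := {
  seminorms : nat -> E -> R;
  seminormsP : forall p, is_seminorm (seminorms p)
}.
HB.builders Context R E & Lmodule_isSeminormed R E.
Notation q := seminorms.
HB.instance Definition _ := hasNbhs.Build E (seminorm_nbhs q).
HB.instance Definition _ := Nbhs_isNbhsTopological.Build E
  (seminorm_nbhs_filter seminormsP) (seminorm_nbhs_singleton seminormsP)
  (seminorm_nbhs_nbhs seminormsP).

Let dist p := seminorm_dist (seminormsP p).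
Let qge0 p := seminorm_ge0 (seminormsP p).
Let qD p := (seminormsP p).1.
Let qZ p := (seminormsP p).2.

Fact seminormed_add : continuous (fun x : E * E => x.1 + x.2).
Proof.
move=> [x y] U [n [e [e0 nU]]].
exists ([set z | forall p, (p <= n)%N -> q p (z - x) < e / 2],
        [set z | forall p, (p <= n)%N -> q p (z - y) < e / 2]).
  by split; exists n, (e / 2); split=> //; rewrite divr_gt0.
move=> [a b] /= [ax byy]; apply: nU => p pn /=.
rewrite opprD addrACA (le_lt_trans (qD _ _ _))// [ltRHS]splitr.
by rewrite ltrD ?(ax _ pn) ?(byy _ pn).
Qed.

Fact seminormed_scale : continuous (fun z : R^o * E => z.1 *: z.2).
Proof.
move=> [a x] U [n [e [e0 nU]]].
pose M := \sum_(i < n.+1) q i x + 1.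
have qM p : (p <= n)%N -> q p x < M.
  move=> pn; rewrite /M (bigD1 (Ordinal (pn : (p < n.+1)%N)))//= -addrA.
  by rewrite ltrDl ltr_wpDl//; apply: sumr_ge0 => i _; exact: qge0.
have M0 : 0 < M by exact: le_lt_trans (qge0 0%N x) (qM 0%N (leq0n n)).
have A0 : 0 < `|a| + 1 by rewrite ltr_wpDl.
pose d1 := Num.min 1 (e / 2 / M).
have d10 : 0 < d1 by rewrite lt_min ltr01 !divr_gt0.
pose d2 := e / 2 / (`|a| + 1).
have d20 : 0 < d2 by rewrite !divr_gt0.
exists ([set b : R^o | `|a - b| < d1],
        [set z | forall p, (p <= n)%N -> q p (z - x) < d2]).
  split; last by exists n, d2; split.
  exact: (@nbhsx_ballx _ R^o a d1 d10).
move=> [b y] /= [ab yx]; apply: nU => p pn /=.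
have -> : b *: y - a *: x = b *: (y - x) + (b - a) *: x.
  by rewrite scalerBr scalerBl addrA subrK.
rewrite (le_lt_trans (qD _ _ _))// !qZ [ltRHS]splitr.
move: ab; rewrite distrC lt_min => /andP[ab1 ab2].
have ba : `|b| <= `|a| + 1.
  rewrite -[b](subrK a) addrC (le_trans (ler_normD _ _))// lerD2l; exact: ltW.
apply: ltr_leD.
  rewrite (le_lt_trans (ler_wpM2r (qge0 _ _) ba))//.
  by rewrite mulrC -ltr_pdivlMr//; exact: yx.
rewrite (le_trans (ler_wpM2l (normr_ge0 _) (ltW (qM p pn))))//.
by rewrite -ler_pdivlMr// ltW.
Qed.

Local Open Scope convex_scope.
Fact seminormed_convex : exists2 B : set_system (convex_lmodType E),
  (forall b, b \in B -> convex_set b) & basis B.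
Proof.
pose Q n x := \sum_(i < n.+1) q i x.
have QD n x y : Q n (x + y) <= Q n x + Q n y.
  by rewrite /Q -big_split; apply: ler_sum => i _; exact: qD.
have QZ n a x : Q n (a *: x) = `|a| * Q n x.
  by rewrite /Q mulr_sumr; apply: eq_bigr => i _; exact: qZ.
have Qq n p x : (p <= n)%N -> q p x <= Q n x.
  move=> pn; rewrite /Q (bigD1 (Ordinal (pn : (p < n.+1)%N)))//=.
  by rewrite lerDl; apply: sumr_ge0 => i _; exact: qge0.
exists [set A | exists x n e, A = [set y | Q n (y - x) < e]].
  move=> b; rewrite inE => -[x [n [e ->]]].
  apply/convex_setW => y z; rewrite !inE /= => yx zx l l0 l1; rewrite inE/=.
  rewrite [X in Q n X](_ : _ =
      l%:num *: (y - x) + (1 - l%:num) *: (z - x)); last first.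
    by rewrite !scalerBr addrACA -opprD -scalerDl addrCA subrr addr0 scale1r.
  have l1' : 0 < 1 - l%:num :> R by rewrite subr_gt0.
  rewrite (le_lt_trans (QD _ _ _))// !QZ.
  rewrite (@ger0_norm _ l%:num)// (@ger0_norm _ (1 - _)) ?(ltW l1')//.
  rewrite [ltRHS](_ : _ = l%:num * e + (1 - l%:num) * e); last by ring.
  by rewrite ltrD// ltr_pM2l.
split.
  move=> _ [x [n [e ->]]]; rewrite openE => y /= Qe; rewrite /interior.
  exists n, ((e - Q n (y - x)) / n.+1%:R); split.
    by rewrite divr_gt0// subr_gt0.
  move=> z /= H.
  have Qz : Q n (z - y) < e - Q n (y - x).
    have -> : e - Q n (y - x) = \sum_(i < n.+1) (e - Q n (y - x)) / n.+1%:R.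
      by rewrite sumr_const card_ord -[RHS]mulr_natr divfK.
    apply: ltr_sum; last by move=> i _; apply: H; rewrite -ltnS.
    by apply/hasP; exists ord0 => //; rewrite mem_index_enum.
  have := QD n (z - y) (y - x); rewrite addrA subrK => /le_lt_trans; apply.
  by rewrite -ltrBrDr.
move=> x U [n [e [e0 nU]]].
exists [set y | Q n (y - x) < e].
  split; first by exists x, n, e.
  by rewrite /= subrr /Q big1// => i _; rewrite seminorm0.
by move=> y Qy; apply: nU => p pn; exact: le_lt_trans (Qq _ _ _ pn) Qy.
Qed.

HB.instance Definition _ := PreTopologicalLmod_isTvs.Build R E
  seminormed_add seminormed_scale seminormed_convex.
(* [PreTopologicalLmod_isTvs] only provides the uniform structure. *)
HB.instance Definition _ :=
  PreTopologicalNmodule_isTopologicalNmodule.Build E seminormed_add.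
HB.instance Definition _ :=
  TopologicalNmodule_isTopologicalLmodule.Build R E seminormed_scale.
HB.instance Definition _ := Uniform_isTvs.Build R E seminormed_convex.
HB.end.

Section Sequences.
Variable R : realType.

(* A test function [s = \sum_n s_n e_n] and a formal series
   [xi = \sum_n xi_n e_n] are represented by their coefficients; the basis is
   indexed from 0, so that the n-th weight is n.+1. *)
Definition rapid_pred : {pred nat -> R} := fun s =>
  `[< forall p, exists2 C, 0 < C & forall n, `|s n| <= C / n.+1%:R ^+ p >].

Fact rapid_submod : subsemimod_closed rapid_pred.
Proof.
split; first split.
- apply/asboolP => p; exists 1 => // n.
  by rewrite normr0 divr_ge0 ?exprn_ge0.
- move=> s t /asboolP hs /asboolP ht; apply/asboolP => p.
  have [C C0 hC] := hs p; have [D D0 hD] := ht p.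
  exists (C + D); first exact: addr_gt0.
  by move=> n; rewrite mulrDl (le_trans (ler_normD _ _))// lerD.
- move=> a s /asboolP hs; apply/asboolP => p; have [C C0 hC] := hs p.
  exists ((`|a| + 1) * C); first by rewrite mulr_gt0// ltr_wpDl.
  move=> n; rewrite -[(a *: s) n]/(a * s n) normrM -mulrA.
  by rewrite ler_pM// lerDl.
Qed.
HB.instance Definition _ :=
  GRing.isSubmodClosed.Build R (nat -> R) rapid_pred rapid_submod.

Record test_space := TestSequence {
  test_seq :> nat -> R;
  test_seqP : test_seq \in rapid_pred }.
HB.instance Definition _ := [isSub for test_seq].
HB.instance Definition _ := [Choice of test_space by <:].
HB.instance Definition _ := [SubChoice_isSubLmodule of test_space by <:].

Definition tempered_pred : {pred nat -> R} := fun xi =>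
  `[< exists p, exists2 C, 0 < C & forall n, `|xi n| <= C * n.+1%:R ^+ p >].

Fact tempered_submod : subsemimod_closed tempered_pred.
Proof.
split; first split.
- by apply/asboolP; exists 0%N, 1 => // n; rewrite normr0 mulr_ge0.
- move=> s t /asboolP[p [C C0 hC]] /asboolP[r [D D0 hD]]; apply/asboolP.
  exists (maxn p r), (C + D); first exact: addr_gt0.
  move=> n; rewrite mulrDl (le_trans (ler_normD _ _))// lerD//.
    by rewrite (le_trans (hC n))// ler_wpM2l ?(ltW C0)// ler_weXn2l ?leq_maxl// ler1n.
  by rewrite (le_trans (hD n))// ler_wpM2l ?(ltW D0)// ler_weXn2l ?leq_maxr// ler1n.
- move=> a s /asboolP[p [C C0 hC]]; apply/asboolP; exists p, ((`|a| + 1) * C).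
    by rewrite mulr_gt0// ltr_wpDl.
  move=> n; rewrite -[(a *: s) n]/(a * s n) normrM -mulrA.
  by rewrite ler_pM// lerDl.
Qed.
HB.instance Definition _ :=
  GRing.isSubmodClosed.Build R (nat -> R) tempered_pred tempered_submod.

Record distribution_space := Distribution {
  dist_seq :> nat -> R;
  dist_seqP : dist_seq \in tempered_pred }.
HB.instance Definition _ := [isSub for dist_seq].
HB.instance Definition _ := [Choice of distribution_space by <:].
HB.instance Definition _ := [SubChoice_isSubLmodule of distribution_space by <:].

Definition pairing (s : test_space) (xi : distribution_space) : R :=
  limn (series (fun n => s n * xi n)).

Definition weighted_norm (p : nat) (s : test_space) : R :=
  Num.sqrt (limn (series (fun n => n.+1%:R ^+ p * `|s n| ^+ 2))).


Let inv_square_cvg : cvgn (series (fun n => n.+1%:R ^- 2 : R)).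
Proof.
apply: nondecreasing_is_cvgn.
  by apply: nondecreasing_series => n _ _; rewrite invr_ge0 exprn_ge0.
exists 2 => _ [n _ <-].
suff H : series (fun n => n.+1%:R ^- 2 : R) n <= 2 - n%:R^-1.
  by rewrite (le_trans H)// gerBl invr_ge0.
elim: n => [|[|n] IH].
- by rewrite /series/= big_geq// invr0; lra.
- by rewrite /series/= big_nat1 expr1n invr1; lra.
rewrite seriesSr (le_trans (lerD IH (lexx _)))//.
have -> : n.+2%:R = n.+1%:R + 1 :> R by rewrite -natr1.
have : 0 < n.+1%:R :> R by rewrite ltr0n.
move: (n.+1%:R : R) => x x0.
have x1 : 0 < x + 1 by rewrite addr_gt0.
rewrite -subr_ge0.
have -> : 2 - (x + 1)^-1 - (2 - x^-1 + (x + 1) ^- 2) = (x * (x + 1) ^+ 2)^-1.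
  by field; rewrite !gt_eqF.
by rewrite invr_ge0 mulr_ge0 ?exprn_ge0 ?ltW.
Qed.

Let weighted_inner (p : nat) (s t : test_space) : R :=
  limn (series (fun n => n.+1%:R ^+ p * (s n * t n))).

Let weighted_cvg p (s t : test_space) :
  cvgn (series (fun n => n.+1%:R ^+ p * (s n * t n))).
Proof.
apply: normed_cvg => /=.
have [/asboolP hs /asboolP ht] := (test_seqP s, test_seqP t).
have [C C0 hC] := hs p; have [D D0 hD] := ht 2%N.
apply: (@series_le_cvg _ _ (fun n => (C * D) *: (n.+1%:R ^- 2 : R))).
- by move=> n; exact: normr_ge0.
- move=> n; apply: mulr_ge0; first by apply: mulr_ge0; exact: ltW.
  by rewrite invr_ge0 exprn_ge0.
- move=> n; rewrite /= !normrM normrX (ger0_norm (ler0n _ _)) /GRing.scale/=.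
  have n0 : 0 < n.+1%:R :> R by rewrite ltr0n.
  have np : 0 < n.+1%:R ^+ p :> R by rewrite exprn_gt0.
  rewrite mulrA -[leRHS]mulrA; apply: ler_pM => //.
  by rewrite mulrC -ler_pdivlMr.
- exact: is_cvg_seriesZ inv_square_cvg.
Qed.

Let weighted_normE p s : weighted_norm p s = Num.sqrt (weighted_inner p s s).
Proof.
congr (Num.sqrt (limn (series _))); apply/funext => n.
by rewrite real_normK ?num_real// expr2.
Qed.

Let weighted_sym p s t : weighted_inner p s t = weighted_inner p t s.
Proof. by congr (limn (series _)); apply/funext => n; rewrite [s n * _]mulrC. Qed.

Let weighted_linear p a s t u : weighted_inner p (a *: s + t) u =
  a * weighted_inner p s u + weighted_inner p t u.
Proof.
rewrite /weighted_inner -[a * _]/(a *: _) -lim_seriesZ; last exact: weighted_cvg.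
rewrite -lim_seriesD; [|exact/is_cvg_seriesZ/weighted_cvg|exact: weighted_cvg].
congr (limn (series _)); apply/funext => n.
have -> : (a *: s + t : test_space) n = a * s n + t n by [].
by rewrite -[RHS]/(a * (n.+1%:R ^+ p * (s n * u n)) + n.+1%:R ^+ p * (t n * u n)); ring.
Qed.

Let weighted_ge0 p s : 0 <= weighted_inner p s s.
Proof.
apply: limr_ge; first exact: weighted_cvg.
near=> n; apply: sumr_ge0 => i _.
by rewrite mulr_ge0 ?exprn_ge0// -expr2 sqr_ge0.
Unshelve. all: by end_near. Qed.

Fact weighted_norm_seminorm p : is_seminorm (weighted_norm p).
Proof.
split=> [s t|a s]; rewrite !weighted_normE.
  by apply: semi_inner_triangle; [exact: weighted_sym|exact: weighted_linear|
    exact: weighted_ge0].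
by apply: semi_inner_homog; [exact: weighted_sym|exact: weighted_linear].
Qed.

HB.instance Definition _ :=
  Lmodule_isSeminormed.Build R test_space weighted_norm_seminorm.
End Sequences.

Definition is_frechet (R : realType) (E : tvsType R) : Prop :=
  hausdorff_space E /\
  exists q : nat -> E -> R,
    [/\ forall p, is_seminorm (q p),
        forall x U, nbhs x U <-> seminorm_nbhs q x U
      & forall u : nat -> E,
          (forall p eps, 0 < eps -> exists N, forall m n,
            (N <= m)%N -> (N <= n)%N -> q p (u m - u n) < eps) ->
          exists l : E, u @ \oo --> l].

(* Nuclearity in the sense of Grothendieck. *)
Definition nuclear (R : realType) (E : tvsType R) (F : normedModType R)
    (T : E -> F) : Prop :=
  exists (lam : nat -> R) (f : nat -> {scalar E}) (y : nat -> F),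
    [/\ cvgn (series (fun n => `|lam n|)),
        equicontinuous [set: nat] (fun n => f n : E -> R),
        exists M, forall n, `|y n| <= M
      & forall x, series (fun n => (lam n * f n x) *: y n) @ \oo --> T x].

(* The topology of S is strictly finer than the one pulled back along i. *)
Definition strictly_finer (S H : topologicalType) (i : S -> H) : Prop :=
  continuous i /\
  exists2 W : set S, open W & forall U : set H, open U -> i @^-1` U <> W.

(* S' is the continuous dual of S through the bilinear pairing. *)
Definition is_dual (R : realType) (S : tvsType R) (S' : lmodType R)
    (pair : S -> S' -> R) : Prop :=
  [/\ forall s, scalar (pair s),
      forall xi, scalar (pair ^~ xi) /\ continuous (pair ^~ xi : S -> R)
    & forall f : {scalar S}, continuous (f : S -> R) ->
        exists! xi, forall s, f s = pair s xi].

Definition is_hilbert (R : realType) (H : normedModType R)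
    (ip : {dot H for idfun}) : Prop :=
  (forall h, `|h| ^+ 2 = ip h h) /\
  (forall F : set_system H, ProperFilter F -> cauchy F -> cvg F).

(* i is the inclusion of S in H; H is included in S' by h |-> <., h>. *)
Record gelfand_triple (R : realType) (S : tvsType R) (H : normedModType R)
    (ip : {dot H for idfun}) (S' : lmodType R)
    (i : S -> H) (pair : S -> S' -> R) : Prop := GelfandTriple {
  gelfand_hilbert : is_hilbert ip;
  gelfand_frechet : is_frechet S;
  gelfand_subspace : linear i /\ injective i;
  gelfand_dense : dense (range i);
  gelfand_finer : strictly_finer i;
  gelfand_nuclear : nuclear i;
  gelfand_dual : is_dual pair;
  gelfand_embedding : exists2 j : {linear H -> S'},
    injective j & forall s h, pair s (j h) = ip (i s) h
}.

Section GramSchmidt.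
Variables (R : realType) (H : lmodType R) (ip : {dot H for idfun}).

Fixpoint gram_schmidt_seq (v : nat -> H) (n : nat) : seq H :=
  if n is m.+1 then
    let s := gram_schmidt_seq v m in
    let w := v m - \sum_(e <- s) ip (v m) e *: e in
    rcons s ((Num.sqrt (ip w w))^-1 *: w)
  else [::].

Definition gram_schmidt (v : nat -> H) (n : nat) : H :=
  last 0 (gram_schmidt_seq v n.+1).

End GramSchmidt.

Section EnergyBasis.
Variables (R : realType) (V : choiceType) (N : network R V).

(* [get] selects the unique element of the set (Riesz representation). *)
Definition energy_kernel (o x : V) : energy_space N :=
  get [set v : energy_space N |
    forall u : energy_space N, energy_inner v u = increment u x o].

Definition energy_basis (o : V) (x : nat -> V) : nat -> energy_space N :=
  gram_schmidt (@energy_inner R V N) (fun n => energy_kernel o (x n)).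

(* s |-> \sum_n s_n e_n, where e is the energy basis *)
Definition test_inclusion (o : V) (x : nat -> V) (s : test_space R) :
    energy_space N :=
  limn (series (fun n => s n *: energy_basis o x n)).

End EnergyBasis.

(* Main.v *)
(* The energy space is complete (Fatou on finite edge sums), so the energy kernels
   exist by Riesz. The point masses form a dual family of the kernels, hence
   Gram-Schmidt never meets a zero vector, and an element orthogonal to all kernels
   is constant: the energy basis is an orthonormal basis. For any orthonormal basis
   (e_n) of a Hilbert space, s = \sum_n (n + 1)^-2 ((n + 1)^2 s_n) e_n exhibits the
   inclusion of the rapidly decreasing sequences as nuclear, and their continuous
   dual is read off from the values at the unit sequences. *)
Require Import Defs.
From HB Require Import structures.
From mathcomp Require Import all_boot all_order all_algebra.
From mathcomp Require Import all_classical all_reals all_analysis.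
From mathcomp Require Import ring lra finmap.
Set Implicit Arguments.
Unset Strict Implicit.
Unset Printing Implicit Defensive.

Import Order.TTheory GRing.Theory Num.Theory numFieldNormedType.Exports.

Local Open Scope classical_set_scope.
Local Open Scope ring_scope.

(** * Orthonormal systems in Hilbert spaces *)

(** Elements of the energy space are classes modulo constants and have no point values; the
    increments [u(x) - u(o)] stand in for them. Connectedness makes each increment a bounded
    functional, because every edge on a path from [x] to [o] costs at most a multiple of the norm.
    This one estimate serves twice: it turns a Cauchy filter into a pointwise limit for
    completeness, and it is the hypothesis of Riesz for the kernels. The point masses lie in the
    space because [c(x)] is finite. The exponent 2 in the nuclear decomposition comes from the
    summability of [(n + 1)^-2]; the same two spare powers make the pairing with a distribution
    converge and depend continuously on the test function. Since the seminorms weight squares, a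
    bound on [(n + 1)^p |s_n|] is read off from the seminorm of index [2 p]. *)

Section DotProduct.
Variables (R : realType) (H : lmodType R) (ip : {dot H for idfun}).
Implicit Types u v w : H.

Lemma ipC u v : ip u v = ip v u.
Proof. by rewrite hermC expr0 mul1r. Qed.

(* Restated because the bilinear lemmas leave [ip] under another coercion. *)
Lemma ip0l v : ip 0 v = 0. Proof. exact: linear0l. Qed.
Lemma ipDl u v w : ip (u + v) w = ip u w + ip v w. Proof. exact: linearDl. Qed.
Lemma ipDr u v w : ip u (v + w) = ip u v + ip u w. Proof. exact: linearDr. Qed.
Lemma ipBl u v w : ip (u - v) w = ip u w - ip v w. Proof. exact: linearBl. Qed.
Lemma ipBr u v w : ip u (v - w) = ip u v - ip u w. Proof. exact: linearBr. Qed.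

Lemma ip_suml (I : Type) (r : seq I) (P : pred I) (f : I -> H) v :
  ip (\sum_(i <- r | P i) f i) v = \sum_(i <- r | P i) ip (f i) v.
Proof. exact: linear_sumlz. Qed.

Lemma ip_sumr (I : Type) (r : seq I) (P : pred I) (f : I -> H) v :
  ip v (\sum_(i <- r | P i) f i) = \sum_(i <- r | P i) ip v (f i).
Proof. exact: linear_sumr. Qed.

Lemma ipZl a u v : ip (a *: u) v = a * ip u v.
Proof. exact: linearZl_LR. Qed.

Lemma ipZr a u v : ip u (a *: v) = a * ip u v.
Proof. by rewrite ipC ipZl ipC. Qed.

Lemma ip_ge0 u : 0 <= ip u u.
Proof. by have [->|/(@neq0_dnorm_gt0 _ _ _ ip)/ltW//] := eqVneq u 0; rewrite ip0l. Qed.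

Lemma ip_CS u v : ip u v ^+ 2 <= ip u u * ip v v.
Proof.
apply: semi_inner_CS; [exact: ipC| |exact: ip_ge0] => a x y z.
by rewrite ipDl ipZl.
Qed.

Section Orthonormal.
Variable e : nat -> H.
Hypothesis orthonormal_e : forall i j, ip (e i) (e j) = (i == j)%:R.

Lemma orthonormal_sum_coef a m n j : (m <= j < n)%N ->
  ip (\sum_(m <= i < n) a i *: e i) (e j) = a j.
Proof.
move=> mjn; rewrite ip_suml (bigD1_seq j) ?iota_uniq ?mem_index_iota//=.
rewrite ipZl orthonormal_e eqxx mulr1 big1 ?addr0// => i /negPf ij.
by rewrite ipZl orthonormal_e ij mulr0.
Qed.

Lemma orthonormal_sum_ip a b m n :
  ip (\sum_(m <= i < n) a i *: e i) (\sum_(m <= i < n) b i *: e i) =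
  \sum_(m <= i < n) a i * b i.
Proof.
rewrite ip_sumr; apply: eq_big_nat => i mn.
by rewrite ipZr orthonormal_sum_coef// mulrC.
Qed.

(** Expand [0 <= ip (h - P) (h - P)] for the projection [P] of [h] on the first [n] vectors, for
    which [ip h P = ip P P]. *)
Lemma bessel h n : \sum_(0 <= i < n) ip h (e i) ^+ 2 <= ip h h.
Proof.
pose P := \sum_(0 <= i < n) ip h (e i) *: e i.
have PP : ip P P = \sum_(0 <= i < n) ip h (e i) ^+ 2.
  by rewrite orthonormal_sum_ip; apply: eq_bigr => i _; rewrite expr2.
have hP : ip h P = \sum_(0 <= i < n) ip h (e i) ^+ 2.
  by rewrite ip_sumr; apply: eq_bigr => i _; rewrite ipZr expr2.
have := ip_ge0 (h - P).
by rewrite ipBl !ipBr PP (ipC P h) hP; lra.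
Qed.

End Orthonormal.

(** * Gram-Schmidt in the presence of a dual family *)

Section GramSchmidt.
Variables v w : nat -> H.
Hypothesis vw : forall n m, ip (v n) (w m) = (n == m)%:R.
Local Notation e := (gram_schmidt ip v).

(** Trades the recursion on lists for an indexed one, so that residues become sums over [i < n] and
    strong induction applies. *)
Lemma gram_schmidt_seqE n : gram_schmidt_seq ip v n = mkseq e n.
Proof.
elim: n => // n IH; rewrite mkseqS -IH /=; congr rcons.
by rewrite /gram_schmidt /= last_rcons.
Qed.

Let rest n := v n - \sum_(0 <= i < n) ip (v n) (e i) *: e i.
Let rest_norm n := Num.sqrt (ip (rest n) (rest n)).

Let gram_schmidtE n : e n = (rest_norm n)^-1 *: rest n.
Proof.
by rewrite [LHS]/gram_schmidt /= last_rcons gram_schmidt_seqE big_map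
  /rest_norm /rest /index_iota subn0.
Qed.

(* The dual family w keeps the Gram-Schmidt residues away from 0. *)
Let dual_ip n m : (n < m)%N -> ip (e n) (w m) = 0.
Proof.
elim/ltn_ind: n m => n IH m nm; rewrite gram_schmidtE ipZl /rest ipBl vw ltn_eqF//.
rewrite ip_suml big_nat big1 ?subrr ?mulr0// => i /andP[_ ilt].
by rewrite ipZl IH ?mulr0// (ltn_trans ilt).
Qed.

Let rest_neq0 n : rest n != 0.
Proof.
apply/eqP => r0; have : ip (rest n) (w n) = 1.
  rewrite /rest ipBl vw eqxx ip_suml big_nat big1 ?subr0// => i /andP[_ ilt].
  by rewrite ipZl dual_ip ?mulr0.
by rewrite r0 ip0l => /esym/eqP; rewrite oner_eq0.
Qed.

Lemma gram_schmidt_orthonormal i j : ip (e i) (e j) = (i == j)%:R.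
Proof.
wlog ij : i j / (i <= j)%N.
  by move=> W; case/orP: (leq_total i j) => /W//; rewrite ipC eq_sym.
elim/ltn_ind: j i ij => j IH i; rewrite leq_eqVlt => /orP[/eqP ->|ij].
  rewrite eqxx gram_schmidtE ipZl ipZr /rest_norm mulrA -expr2 exprVn sqr_sqrtr ?ip_ge0//.
  by rewrite mulVf// gt_eqF// neq0_dnorm_gt0.
rewrite (ltn_eqF ij) (gram_schmidtE j) ipZr /rest ipBr ip_sumr.
rewrite (bigD1_seq i) ?iota_uniq ?mem_index_iota//= big_nat_cond big1.
  by rewrite addr0 ipZr IH// eqxx mulr1 (ipC (v j)) subrr mulr0.
move=> k /andP[/andP[_ kj] ki]; rewrite ipZr.
(* Both [i] and [k] lie below [j], so the induction hypothesis applies at the larger of the two. *)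
suff -> : ip (e i) (e k) = 0 by rewrite mulr0.
have [ik|ki'] := leqP i k; first by rewrite IH// eq_sym (negPf ki).
by rewrite ipC IH ?(ltnW ki')// (negPf ki).
Qed.

(** Each [v n] is a combination of [e 0, ..., e n]: its residue is nonzero, so dividing by the norm
    loses nothing. *)
Lemma gram_schmidt_total h : (forall n, ip h (e n) = 0) -> forall n, ip h (v n) = 0.
Proof.
move=> he n; have hr : ip h (rest n) = 0.
  apply/eqP; have /eqP := he n; rewrite gram_schmidtE ipZr mulf_eq0 => /orP[|//].
  by rewrite invr_eq0 sqrtr_eq0 leNgt neq0_dnorm_gt0.
have -> : v n = rest n + \sum_(0 <= i < n) ip (v n) (e i) *: e i.
  by rewrite /rest subrK.
rewrite ipDr hr add0r ip_sumr big1// => i _.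
by rewrite ipZr he mulr0.
Qed.

End GramSchmidt.
End DotProduct.

(** * Riesz representation and orthonormal series *)

Section Hilbert.
Variables (R : realType) (H : normedModType R) (ip : {dot H for idfun}).
Hypothesis hilbert_ip : is_hilbert ip.
Implicit Types u v w h : H.

Lemma normE_ip h : `|h| ^+ 2 = ip h h. Proof. exact: hilbert_ip.1. Qed.

Lemma ip_norm_le u v : `|ip u v| <= `|u| * `|v|.
Proof.
rewrite -(ler_pXn2r (n := 2))// ?nnegrE ?mulr_ge0//.
by rewrite real_normK ?num_real// exprMn !normE_ip ip_CS.
Qed.

Lemma cvg_ipl (T : Type) (F : set_system T) (f : T -> H) u v : Filter F ->
  f @ F --> u -> ip (f x) v @[x --> F] --> ip u v.
Proof.
move=> FF fu; apply/cvgrPdist_le => eps eps0.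
have d0 : 0 < eps / (`|v| + 1) by rewrite divr_gt0// ltr_wpDl.
move/cvgrPdist_le : fu => /(_ _ d0); apply: filterS => x xd.
rewrite -ipBl (le_trans (ip_norm_le _ _))//.
rewrite (le_trans (ler_wpM2r (normr_ge0 v) xd))//.
by rewrite -mulrA ler_piMr ?(ltW eps0)// mulrC ler_pdivrMr ?ltr_wpDl// mul1r lerDl.
Qed.

Lemma hilbert_cauchy_cvg (u : nat -> H) :
  (forall eps, 0 < eps -> exists N, forall m n, (N <= m)%N -> (N <= n)%N ->
    `|u m - u n| < eps) -> cvgn u.
Proof.
move=> cu; apply: hilbert_ip.2; apply: cauchy_exP => eps /cu[N NP].
exists (u N); exists N => // n /= Nn; rewrite -ball_normE /=.
exact: NP.
Qed.

(* The Riesz vector of f minimizes |u|^2 - 2 f u; minimizing sequences are Cauchy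
   by the parallelogram identity. *)
Lemma riesz (f : {scalar H}) (C : R) : (forall u, `|f u| <= C * `|u|) ->
  exists v, forall u, ip v u = f u.
Proof.
move=> fC; pose phi u := ip u u - 2 * f u.
(* Complete the square in [|u|^2 - 2 C |u|]. *)
have phi_ge u : - C ^+ 2 <= phi u.
  have := fC u; rewrite /phi -normE_ip => /(le_trans (ler_norm _)).
  by have := sqr_ge0 (`|u| - C); nra.
have phi_inf : has_inf (range phi).
  by split; [exists (phi 0), 0|exists (- C ^+ 2) => _ [u _ <-]].
pose m := inf (range phi).
have m_le u : m <= phi u by apply: ge_inf; [exact: phi_inf.2|exists u].
have /choice[u uP] : forall n : nat, exists u, phi u < m + n.+1%:R^-1.
  move=> n; have n0 : 0 < n.+1%:R^-1 :> R by rewrite invr_gt0.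
  by have [_ [u _ <-]] := inf_adherent n0 phi_inf; exists u.
have phi_line w d t : phi (w + t *: d) =
    phi w + t ^+ 2 * ip d d + 2 * t * (ip w d - f d).
  have fl : f (w + t *: d) = f w + t * f d by rewrite linearD linearZ.
  by rewrite /phi fl ipDl !ipDr !ipZl !ipZr (ipC ip d w); ring.
(* Eliminating the linear term of [phi_line] between [t = 1] and [t = 1/2] gives [|d|^2 = 2 (phi (u
   i) + phi (u j)) - 4 phi mid], where [d = u i - u j] and the midpoint value is at least [m]. *)
have u_dist i j : `|u i - u j| ^+ 2 <= 2 * i.+1%:R^-1 + 2 * j.+1%:R^-1.
  have := phi_line (u j) (u i - u j) 2^-1; have := phi_line (u j) (u i - u j) 1.
  rewrite scale1r addrCA subrr addr0 -normE_ip.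
  have := m_le (u j + 2^-1 *: (u i - u j)); have := uP i; have := uP j.
  move: (ip (u j) _ - _) (`|_| ^+ 2) (phi (_ + _)) (phi (u i)) (phi (u j)) => L D p pi pj.
  by move: (i.+1%:R^-1) (j.+1%:R^-1) => a b; lra.
have [v uv] : exists v, u @ \oo --> v.
  have : cvgn u.
    apply: hilbert_cauchy_cvg => eps eps0.
    have [N _ NP] : \forall n \near \oo, n.+1%:R^-1 < eps ^+ 2 / 4 :> R.
      apply: (cvgr_lt 0); last by rewrite divr_gt0 ?exprn_gt0.
      exact: cvg_harmonic.
    exists N => i j /NP /= iN /NP /= jN.
    rewrite -(ltr_pXn2r (n := 2))// ?nnegrE ?(ltW eps0)//.
    rewrite (le_lt_trans (u_dist i j))//; move: iN jN.
    by move: (i.+1%:R^-1) (j.+1%:R^-1) (eps ^+ 2) => a b c; lra.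
  by move=> ?; exists (limn u).
exists v => d.
pose a := ip v d - f d.
(* From [m <= phi (u n + t d)] and [phi (u n) < m + 1 / (n + 1)], the polynomial taken at [u n] is
   at least [- 1 / (n + 1)]; pass to the limit in [n]. *)
have quad t : 0 <= t ^+ 2 * ip d d + 2 * t * a.
  have lhs : (t ^+ 2 * ip d d + 2 * t * (ip (u n) d - f d) @[n --> \oo]) -->
      t ^+ 2 * ip d d + 2 * t * a.
    apply: cvgD; first exact: cvg_cst.
    by apply: cvgMr; apply: cvgB; [exact: cvg_ipl|exact: cvg_cst].
  have rhs : (- n.+1%:R^-1 @[n --> \oo]) --> - (0 : R).
    by apply: cvgN; exact: cvg_harmonic.
  rewrite -oppr0; apply: (ler_cvg_to rhs lhs); apply: nearW => n.
  have := m_le (u n + t *: d); have := uP n; rewrite phi_line.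
  by move: (n.+1%:R^-1) (phi (u n)) (t ^+ 2 * _) (2 * t * _) => a' b c e; lra.
apply/eqP; rewrite -subr_eq0 -/a -sqrf_eq0 eq_le sqr_ge0 andbT.
have := ip_ge0 ip d; move: (ip d d) quad => q quad q0.
have q1 : 0 < q + 1 by rewrite ltr_wpDl.
(* The minimizer would be [- a / q], but [q] vanishes when [d = 0]; the denominator [q + 1] still
   makes the value a negative multiple of [a ^+ 2]. *)
have := quad (- a / (q + 1)).
have -> : (- a / (q + 1)) ^+ 2 * q + 2 * (- a / (q + 1)) * a =
    - a ^+ 2 * ((q + 2) / (q + 1) ^+ 2).
  by field; rewrite gt_eqF.
rewrite mulNr oppr_ge0 pmulr_lle0//.
by rewrite divr_gt0 ?exprn_gt0// ltr_wpDl.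
Qed.

Section OrthonormalSeries.
Variable e : nat -> H.
Hypothesis orthonormal_e : forall i j, ip (e i) (e j) = (i == j)%:R.

Lemma norm_orthonormal n : `|e n| = 1.
Proof.
apply/eqP; rewrite -(@eqrXn2 _ 2)// normE_ip orthonormal_e eqxx expr1n//.
Qed.

Lemma norm_orthonormal_sum a m n :
  `|\sum_(m <= i < n) a i *: e i| ^+ 2 = \sum_(m <= i < n) a i ^+ 2.
Proof.
rewrite normE_ip orthonormal_sum_ip//; apply: eq_bigr => i _.
Qed.

(** By Pythagoras a block of the vector series has squared norm equal to the same block of the
    scalar series, so the Cauchy conditions match. *)
Lemma orthonormal_series_cvg (a : nat -> R) : cvgn (series (fun n => a n ^+ 2)) ->
  cvgn (series (fun n => a n *: e n)).
Proof.
move=> /cauchy_cvgP/cauchy_seriesP ca; apply: hilbert_ip.2.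
apply/cauchy_seriesP => eps eps0.
have := ca (eps ^+ 2) (exprn_gt0 2 eps0); apply: filterS => n.
rewrite ger0_norm ?sumr_ge0// => [|i _]; last exact: sqr_ge0.
by rewrite -norm_orthonormal_sum ltr_pXn2r ?nnegrE ?(ltW eps0).
Qed.

Lemma orthonormal_series_coef (a : nat -> R) j : cvgn (series (fun n => a n *: e n)) ->
  ip (limn (series (fun n => a n *: e n))) (e j) = a j.
Proof.
move=> ca; pose S := series (fun n => a n *: e n).
have Slim : ip (S n) (e j) @[n --> \oo] --> ip (limn S) (e j) by exact: cvg_ipl.
apply: (cvg_unique _ Slim) => //.
apply: cvg_near_cst; exists j.+1 => // n /= jn.
by rewrite /S /series /= orthonormal_sum_coef.
Qed.

Lemma orthonormal_series_norm (a : nat -> R) : cvgn (series (fun n => a n *: e n)) ->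
  series (fun n => a n ^+ 2) @ \oo -->
    `|limn (series (fun n => a n *: e n))| ^+ 2.
Proof.
move=> ca; rewrite (_ : series _ = fun n => `|series (fun n => a n *: e n) n| ^+ 2).
  by rewrite expr2; apply: cvgM; apply: cvg_norm.
by apply/funext => n; rewrite norm_orthonormal_sum.
Qed.

Hypothesis total_e : forall h, (forall n, ip h (e n) = 0) -> h = 0.

(** Bessel makes the series converge, and its limit has the same coefficients as [h]; totality
    identifies the two. *)
Lemma orthonormal_expansion h :
  series (fun n => ip h (e n) *: e n) @ \oo --> h.
Proof.
have c : cvgn (series (fun n => ip h (e n) *: e n)).
  apply: orthonormal_series_cvg; apply: nondecreasing_is_cvgn.
    by apply: nondecreasing_series => n _ _; exact: sqr_ge0.
  by exists (ip h h) => _ [n _ <-]; exact: bessel.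
suff lim_h : limn (series (fun n => ip h (e n) *: e n)) = h.
  by rewrite -[X in _ --> X]lim_h.
apply/eqP; rewrite -subr_eq0; apply/eqP/total_e => n.
by rewrite ipBl orthonormal_series_coef// subrr.
Qed.

End OrthonormalSeries.
End Hilbert.

(** * Rapidly decreasing sequences *)

Section RapidSequences.
Variable R : realType.
Local Notation S := (test_space R).
Local Notation q := (@weighted_norm R).
Implicit Types s t : S.

Lemma inv_square_series_cvg : cvgn (series (fun n => n.+1%:R ^- 2 : R)).
Proof.
(* The telescoping majorant is [2 / ((n + 1) (n + 2))]; the factor 2 is what the comparison needs at
   [n = 0]. *)
pose u n : R := - 2 / n.+1%:R.
have cu : cvgn (series (telescope u)).
  rewrite telescopeK; apply: is_cvgB; last exact: is_cvg_cst.
  apply: is_cvgMr; apply/cvg_ex; exists 0; exact: cvg_harmonic.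
apply: series_le_cvg cu => n; rewrite /telescope /u.
- by rewrite invr_ge0 exprn_ge0.
- by rewrite subr_ge0 ler_nM2l ?lef_pV2 ?posrE ?ltr0n ?oppr_lt0// ler_nat.
have : 1 <= n.+1%:R :> R by rewrite ler1n.
rewrite /= -(natr1 n.+1); move: (n.+1%:R : R) => x x1.
have x0 : 0 < x by lra.
rewrite -subr_ge0.
have -> : - 2 / (x + 1) - - 2 / x - x ^- 2 = (x - 1) / (x ^+ 2 * (x + 1)).
  by field; rewrite !gt_eqF// addr_gt0.
by rewrite divr_ge0 ?subr_ge0// mulr_ge0 ?exprn_ge0 ?addr_ge0// ltW.
Qed.

Lemma rapid_bound s p : exists2 C, 0 < C & forall n, n.+1%:R ^+ p * `|s n| <= C.
Proof.
have /asboolP/(_ p)[C C0 sC] := test_seqP s; exists C => // n.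
by rewrite mulrC -ler_pdivlMr ?exprn_gt0.
Qed.

(** Decay of order [p + 2] absorbs the growth of [b] and leaves the summable weight [(n + 1)^-2]. *)
Lemma rapid_summable s (b : nat -> R) D p :
  (forall n, `|b n| <= D * n.+1%:R ^+ p) -> cvgn [normed series (fun n => s n * b n)].
Proof.
move=> bD; have [C C0 sC] := rapid_bound s (p + 2).
have D0 : 0 <= D by have := bD 0%N; rewrite expr1n mulr1; exact: le_trans.
apply: (@series_le_cvg _ _ (fun n => (C * D) *: (n.+1%:R ^- 2 : R))).
- by move=> n; exact: normr_ge0.
- move=> n; apply: mulr_ge0; first by apply: mulr_ge0 => //; exact: ltW.
  by rewrite invr_ge0 exprn_ge0.
- move=> n; rewrite /= /GRing.scale /= normrM ler_pdivlMr ?exprn_gt0//.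
  rewrite (le_trans (ler_wpM2r _ (ler_wpM2l _ (bD n))))//.
  have -> : `|s n| * (D * n.+1%:R ^+ p) * n.+1%:R ^+ 2 =
      D * (n.+1%:R ^+ (p + 2) * `|s n|) by rewrite exprD; ring.
  by rewrite (mulrC C) ler_wpM2l.
- exact: is_cvg_seriesZ inv_square_series_cvg.
Qed.

Lemma weighted_series_cvg p s :
  cvgn (series (fun n => n.+1%:R ^+ p * `|s n| ^+ 2)).
Proof.
have [C C0 sC] := rapid_bound s 0.
rewrite (_ : series _ = [normed series (fun n => s n * (n.+1%:R ^+ p * s n))]).
  apply: (@rapid_summable _ _ C p) => n.
  rewrite normrM ger0_norm ?exprn_ge0// mulrC ler_wpM2r ?exprn_ge0//.
  by have := sC n; rewrite expr0 mul1r.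
congr series; apply/funext => n /=.
by rewrite !normrM (@ger0_norm _ (_ ^+ p)) ?exprn_ge0//; ring.
Qed.

Lemma weighted_normE p s :
  weighted_norm p s ^+ 2 = limn (series (fun n => n.+1%:R ^+ p * `|s n| ^+ 2)).
Proof.
rewrite sqr_sqrtr//; apply: limr_ge; first exact: weighted_series_cvg.
by apply: nearW => n; apply: sumr_ge0 => i _; rewrite mulr_ge0 ?exprn_ge0.
Qed.

Lemma weighted_norm_ge0 p s : 0 <= q p s. Proof. exact: sqrtr_ge0. Qed.

Lemma weighted_norm_ge_sum p s K :
  \sum_(0 <= n < K) n.+1%:R ^+ p * `|s n| ^+ 2 <= q p s ^+ 2.
Proof.
rewrite weighted_normE.
apply: (nondecreasing_cvgn_le _ (@weighted_series_cvg p s) K).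
by apply: nondecreasing_series => n _ _; rewrite mulr_ge0 ?exprn_ge0.
Qed.

Lemma weighted_norm_le p s e : 0 <= e ->
  (forall K, \sum_(0 <= n < K) n.+1%:R ^+ p * `|s n| ^+ 2 <= e ^+ 2) -> q p s <= e.
Proof.
move=> e0 se; rewrite -(ler_pXn2r (n := 2))// ?nnegrE ?weighted_norm_ge0//.
rewrite weighted_normE; apply: limr_le; first exact: weighted_series_cvg.
by apply: nearW => K; exact: se.
Qed.

(** Keep one term of the series; taking the square root halves the exponent, whence [p.*2]. This
    links the quadratic seminorms with pointwise decay. *)
Lemma weighted_norm_coef p s n : n.+1%:R ^+ p * `|s n| <= q p.*2 s.
Proof.
rewrite -(ler_pXn2r (n := 2))// ?nnegrE ?mulr_ge0 ?exprn_ge0 ?weighted_norm_ge0//.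
apply: le_trans (weighted_norm_ge_sum _ _ n.+1).
rewrite big_nat_recr//= exprMn -exprM muln2 lerDr.
by apply: sumr_ge0 => i _; rewrite mulr_ge0 ?exprn_ge0.
Qed.

Lemma weighted_norm_mono p r s : (p <= r)%N -> q p s <= q r s.
Proof.
move=> pr; apply: weighted_norm_le => [|K]; first exact: weighted_norm_ge0.
apply: le_trans (weighted_norm_ge_sum _ _ K); apply: ler_sum => n _.
by rewrite ler_wpM2r ?exprn_ge0// ler_weXn2l// ler1n.
Qed.

(** The seminorms increase with their index, so the last of finitely many conditions implies the
    others. *)
Lemma test_nbhsP s (U : set S) :
  nbhs s U <-> exists n e, 0 < e /\ forall t, q n (t - s) < e -> U t.
Proof.
split=> [[n [e [e0 nU]]]|[n [e [e0 nU]]]]; exists n, e; split => // t tU.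
  by apply: nU => p /= /weighted_norm_mono pn; exact: le_lt_trans (pn _) tU.
by apply: nU; exact: tU.
Qed.

Lemma test_cvgP (T : Type) (F : set_system T) (u : T -> S) s : Filter F ->
  (forall p e, 0 < e -> \forall x \near F, q p (u x - s) < e) -> u @ F --> s.
Proof.
move=> FF us U /test_nbhsP[n [e [e0 nU]]].
by apply: filterS (us n e e0) => x; exact: nU.
Qed.

Lemma test_linear_continuous (F : normedModType R) (f : S -> F) C p :
  (forall s t, f (s - t) = f s - f t) -> (forall s, `|f s| <= C * q p s) ->
  continuous f.
Proof.
move=> fB fC s; have FF := nbhs_filter s; apply/cvgrPdist_lt => e e0; apply/test_nbhsP.
have C0 : 0 < `|C| + 1 by rewrite ltr_wpDl.
exists p, (e / (`|C| + 1)); split; first by rewrite divr_gt0.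
move=> t ts; rewrite distrC -fB (le_lt_trans (fC _))//.
rewrite (@le_lt_trans _ _ ((`|C| + 1) * q p (t - s)))//.
  rewrite ler_wpM2r ?weighted_norm_ge0// (le_trans (ler_norm C))//.
  by rewrite lerDl.
by rewrite mulrC -ltr_pdivlMr.
Qed.

Lemma test_hausdorff : hausdorff_space S.
Proof.
move=> s t st; apply: val_inj; apply/funext => n; apply/eqP; rewrite -subr_eq0 -normr_eq0.
apply/eqP/le_anti; rewrite normr_ge0 andbT; apply/ler_addgt0Pl => e e0.
rewrite addr0; pose d := e / 2; have d0 : 0 < d by rewrite divr_gt0.
have [||z [/= sz tz]] := st [set z | q 0 (z - s) < d] [set z | q 0 (z - t) < d].
- by apply/test_nbhsP; exists 0%N, d.
- by apply/test_nbhsP; exists 0%N, d.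
have zs := weighted_norm_coef 0 (z - s) n; have zt := weighted_norm_coef 0 (z - t) n.
move: zs zt; rewrite !expr0 !mul1r => zs zt.
rewrite (_ : val s n - val t n = (z - t) n - (z - s) n); last first.
  by rewrite -[LHS]/(s n - t n) -[RHS]/(z n - t n - (z n - s n)); ring.
rewrite (le_trans (ler_normB _ _))// /d (splitr e) lerD//.
  by rewrite (le_trans zt)// ltW.
by rewrite (le_trans zs)// ltW.
Qed.

Lemma test_complete (u : nat -> S) :
  (forall p e, 0 < e -> exists N, forall m n, (N <= m)%N -> (N <= n)%N ->
    q p (u m - u n) < e) -> exists l : S, u @ \oo --> l.
Proof.
move=> cu.
have coef_cvg n : cvgn (fun m => u m n).
  apply: cauchy_cvg; apply: cauchy_exP => e /(cu 0%N)[N NP].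
  exists (u N n); exists N => // m /= Nm; rewrite -ball_normE /=.
  have := weighted_norm_coef 0 (u N - u m) n.
  by rewrite expr0 mul1r => /le_lt_trans; apply; exact: NP.
pose l n := limn (fun m => u m n).
(* Cutting the sum at [K] lets the limit in [k] pass through it, and [N] is chosen independently of
   [K]. *)
have fatou p e : 0 < e -> exists N, forall m K, (N <= m)%N ->
    \sum_(0 <= n < K) n.+1%:R ^+ p * `|u m n - l n| ^+ 2 <= e ^+ 2.
  move=> e0; have [N NP] := cu p e e0; exists N => m K Nm.
  have lim_sum : (\sum_(0 <= n < K) n.+1%:R ^+ p * `|u m n - u k n| ^+ 2) @[k --> \oo]
      --> \sum_(0 <= n < K) n.+1%:R ^+ p * `|u m n - l n| ^+ 2.
    apply: cvg_big => [|n _]; [exact: add_continuous|apply: cvgMr; rewrite expr2].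
    suff c : `|u m n - u k n| @[k --> \oo] --> `|u m n - l n| by apply: cvgM.
    by apply: cvg_norm; apply: cvgB; [exact: cvg_cst|exact: coef_cvg].
  have cst : (fun _ : nat => e ^+ 2) @ \oo --> e ^+ 2 by exact: cvg_cst.
  apply: (ler_cvg_to lim_sum cst).
  exists N => // k /= Nk; apply: le_trans (weighted_norm_ge_sum p (u m - u k) K) _.
  by rewrite ler_pXn2r ?nnegrE ?weighted_norm_ge0 ?(ltW e0)// ltW// NP.
(* In coordinate [n] the limit is within [(n + 1)^-p] of the single test sequence [u N], so it
   inherits decay of order [p]. *)
have l_rapid : l \in @rapid_pred R.
  apply/asboolP => p; have [N NP] := fatou p.*2 1 ltr01.
  have [C C0 uC] := rapid_bound (u N) p.
  exists (C + 1); first exact: addr_gt0.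
  move=> n; rewrite ler_pdivlMr ?exprn_gt0// mulrC.
  have ul : n.+1%:R ^+ p * `|u N n - l n| <= 1.
    rewrite -(ler_pXn2r (n := 2))// ?nnegrE ?mulr_ge0 ?exprn_ge0//.
    apply: le_trans (NP N n.+1 (leqnn N)).
    rewrite big_nat_recr//= exprMn -exprM muln2 lerDr.
    by apply: sumr_ge0 => i _; rewrite mulr_ge0 ?exprn_ge0.
  have -> : l n = u N n - (u N n - l n) by rewrite subKr.
  rewrite (le_trans (ler_wpM2l _ (ler_normB _ _))) ?exprn_ge0// mulrDr.
  by rewrite lerD.
exists (TestSequence l_rapid); apply: test_cvgP => p e e0.
have e20 : 0 < e / 2 by rewrite divr_gt0.
have [N NP] := fatou p (e / 2) e20; exists N => // m /= Nm.
apply: (@le_lt_trans _ _ (e / 2)); last by rewrite gtr_pMr// invf_lt1// ltr1n.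
by apply: weighted_norm_le => [|K]; [exact: ltW|exact: NP].
Qed.

Lemma test_frechet : is_frechet S.
Proof.
split; first exact: test_hausdorff.
exists q; split; [exact: weighted_norm_seminorm|by []|exact: test_complete].
Qed.

(** * The pairing and the continuous dual *)

Lemma pairing_cvg s (xi : distribution_space R) : cvgn (series (fun n => s n * xi n)).
Proof.
have /asboolP[p [C _ xiC]] := dist_seqP xi.
by apply: normed_cvg; apply: rapid_summable xiC.
Qed.

Lemma pairing_linearl (xi : distribution_space R) : scalar ((@pairing R) ^~ xi).
Proof.
move=> a s t; rewrite /pairing -[a * _]/(a *: _) -lim_seriesZ; last exact: pairing_cvg.
rewrite -lim_seriesD; [|exact/is_cvg_seriesZ/pairing_cvg|exact: pairing_cvg].
congr (limn (series _)); apply/funext => n.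
have -> : (a *: s + t : S) n = a * s n + t n by [].
by rewrite -[RHS]/(a * (s n * xi n) + t n * xi n) mulrDl mulrA.
Qed.

Lemma pairing_linearr s : scalar (@pairing R s).
Proof.
move=> a xi psi; rewrite /pairing -[a * _]/(a *: _) -lim_seriesZ; last exact: pairing_cvg.
rewrite -lim_seriesD; [|exact/is_cvg_seriesZ/pairing_cvg|exact: pairing_cvg].
congr (limn (series _)); apply/funext => n.
have -> : (a *: xi + psi : distribution_space R) n = a * xi n + psi n by [].
by rewrite -[RHS]/(a * (s n * xi n) + s n * psi n) mulrDr mulrCA.
Qed.

Lemma pairing_continuous (xi : distribution_space R) :
  continuous (fun s => pairing s xi : R).
Proof.
have /asboolP[p [C C0 xiC]] := dist_seqP xi.
pose Z := limn (series (fun n => n.+1%:R ^- 2 : R)).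
(* The [n]-th term is at most [C (n + 1)^p |s n|], hence at most [C (n + 1)^-2] times the seminorm
   of index [(p + 2).*2]; summing gives [Z]. *)
apply: (@test_linear_continuous R^o _ (C * Z) (p + 2).*2).
  move=> s t; have := pairing_linearl xi (-1) t s.
  by rewrite scaleN1r mulN1r (addrC s) => ->; rewrite addrC.
move=> s; have c := rapid_summable (s := s) xiC.
apply: (le_trans (lim_series_norm c)).
rewrite mulrAC -[leRHS]/((C * q (p + 2).*2 s) *: Z) -lim_seriesZ; last first.
  exact: inv_square_series_cvg.
apply: lim_series_le => //; first exact/is_cvg_seriesZ/inv_square_series_cvg.
move=> n; rewrite -[leRHS]/(C * q (p + 2).*2 s * n.+1%:R ^- 2).
rewrite /= ler_pdivlMr ?exprn_gt0// normrM.
apply: le_trans (ler_wpM2l (ltW C0) (weighted_norm_coef (p + 2) s n)).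
rewrite (_ : C * _ = `|s n| * (C * n.+1%:R ^+ p) * n.+1%:R ^+ 2); last by rewrite exprD; ring.
by rewrite ler_wpM2r ?exprn_ge0// ler_wpM2l.
Qed.

Lemma finite_seq_rapid (a : nat -> R) K :
  (fun n => if (n < K)%N then a n else 0) \in @rapid_pred R.
Proof.
apply/asboolP => p; pose C := \sum_(0 <= n < K) n.+1%:R ^+ p * `|a n|.
have C_ge0 : 0 <= C by apply: sumr_ge0 => n _; rewrite mulr_ge0 ?exprn_ge0.
exists (C + 1); first by rewrite ltr_wpDl.
move=> n; rewrite ler_pdivlMr ?exprn_gt0// mulrC.
case: ifPn => nK; last by rewrite normr0 mulr0 addr_ge0.
rewrite /C (bigD1_seq n) ?iota_uniq ?mem_index_iota//= -addrA lerDl addr_ge0//.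
by apply: sumr_ge0 => i _; rewrite mulr_ge0 ?exprn_ge0.
Qed.

Definition finite_test (a : nat -> R) K : S := TestSequence (finite_seq_rapid a K).

Definition unit_test k : S := finite_test (fun n => (n == k)%:R) k.+1.

Lemma unit_testE k n : unit_test k n = (n == k)%:R.
Proof. by rewrite /= ltnS; case: ltngtP. Qed.

(** Linearity is a bare hypothesis so that the lemma covers both continuous functionals and the
    inclusion into the Hilbert space, which is not bundled as a linear map. *)
Lemma finite_test_linear (V : lmodType R) (f : S -> V) (a : nat -> R) K :
  (forall b s t, f (b *: s + t) = b *: f s + f t) ->
  f (finite_test a K) = \sum_(0 <= k < K) a k *: f (unit_test k).
Proof.
move=> fl.
have f0 : f 0 = 0.
  have /eqP := fl 1 0 0; rewrite !scale1r addr0 -subr_eq0 opprD addrA subrr sub0r.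
  by rewrite oppr_eq0 => /eqP.
elim: K => [|K IH].
  by rewrite big_geq// (_ : finite_test a 0 = 0)//; exact: val_inj.
rewrite big_nat_recr//= -IH addrC -fl; congr f; apply: val_inj; apply/funext => n.
rewrite -[RHS]/(a K * unit_test K n + (if (n < K)%N then a n else 0)) unit_testE /=.
by rewrite ltnS; case: ltngtP => [_|_|->]; rewrite ?mulr0 ?mulr1 ?add0r ?addr0.
Qed.

Lemma weighted_norm_unit p k c : q p (c *: unit_test k) ^+ 2 = k.+1%:R ^+ p * c ^+ 2.
Proof.
rewrite weighted_normE; apply: cvg_lim => //; apply: cvg_near_cst.
exists k.+1 => // n /= kn; rewrite /series /= (bigD1_seq k) ?iota_uniq ?mem_index_iota//=.
rewrite big1 ?addr0 => [|i /negPf ik].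
  by rewrite -[(c *: _) k]/(c * unit_test k k) unit_testE eqxx mulr1 real_normK ?num_real.
by rewrite -[(c *: _) i]/(c * unit_test k i) unit_testE ik mulr0 normr0 expr0n mulr0.
Qed.

Lemma finite_test_cvg s : finite_test s @ \oo --> s.
Proof.
apply: test_cvgP => p e e0.
have e20 : 0 < e / 2 by rewrite divr_gt0.
have /cvgrPdist_lt/(_ _ (exprn_gt0 2 e20)) := weighted_series_cvg (p := p) (s := s).
apply: filterS => n; rewrite -weighted_normE => sn.
apply: (@le_lt_trans _ _ (e / 2)); last by rewrite gtr_pMr// invf_lt1// ltr1n.
apply: weighted_norm_le => [|K]; first exact: ltW.
rewrite (le_trans _ (le_trans (ler_norm _) (ltW sn)))//.
rewrite lerBrDr (le_trans _ (weighted_norm_ge_sum p s (K + n)))//.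
rewrite /series /= [leRHS](big_cat_nat (n := n)) ?leq_addl//= [leLHS]addrC lerD2l.
(* [K] may be smaller than [n]; the longer range can be cut at [n], below which the difference
   vanishes and from which on it is [- s]. *)
apply: (@le_trans _ _ (\sum_(0 <= i < K + n)
    i.+1%:R ^+ p * `|(finite_test s n - s) i| ^+ 2)).
  rewrite [leRHS](big_cat_nat (n := K)) ?leq_addr//= lerDl.
  by apply: sumr_ge0 => i _; rewrite mulr_ge0 ?exprn_ge0.
rewrite (big_cat_nat (n := n)) ?leq_addl//= big_nat big1 ?add0r => [|i /= ilt].
  rewrite big_nat [leRHS]big_nat; apply: ler_sum => i /andP[ni _].
  rewrite -[(_ - _) i]/((if (i < n)%N then s i else 0) - s i).
  by rewrite ltnNge ni sub0r normrN.
rewrite -[(_ - _) i]/((if (i < n)%N then s i else 0) - s i).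
by rewrite ilt subrr normr0 expr0n mulr0.
Qed.

Lemma test_is_dual : is_dual (@pairing R).
Proof.
split; first exact: pairing_linearr.
  by move=> xi; split; [exact: pairing_linearl|exact: pairing_continuous].
move=> f fcont.
have fl b s t : f (b *: s + t) = b *: f s + f t by rewrite linearP.
have f_finite a K : f (finite_test a K) = \sum_(0 <= k < K) a k * f (unit_test k).
  exact: (@finite_test_linear R^o).
have [p [C C0 fC]] : exists p, exists2 C, 0 < C & forall k, `|f (unit_test k)| <= C * k.+1%:R ^+ p.
  have /cvgrPdist_lt/(_ _ ltr01) := fcont 0.
  have f0 : f 0 = 0 by rewrite linear0.
  move=> /test_nbhsP[p [e [e0 fe]]]; exists p, (2 / e); first by rewrite divr_gt0.
  (* The squared seminorm of [c *: unit_test k] is [(e^2 / 4) / (k + 1)^p < e^2], so [f] is below 1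
     there. Dividing by the full power [(k + 1)^p] avoids square roots and still gives polynomial
     growth. *)
  move=> k; pose c := e / 2 / k.+1%:R ^+ p.
  have c0 : 0 < c by rewrite !divr_gt0// exprn_gt0.
  have : `|f (c *: unit_test k)| < 1.
    rewrite -normrN -[- _]add0r -[X in X - _]f0; apply: fe; rewrite subr0.
    rewrite -(ltr_pXn2r (n := 2))// ?nnegrE ?weighted_norm_ge0 ?(ltW e0)//.
    rewrite weighted_norm_unit /c !exprMn.
    have := @ler1n R k.+1; rewrite ltn0Sn => x1.
    have : 1 <= k.+1%:R ^+ p :> R by rewrite exprn_ege1.
    move: (k.+1%:R ^+ p : R) => x {}x1; have x0 : 0 < x by lra.
    have -> : x * (e ^+ 2 * 2^-1 ^+ 2 * x^-1 ^+ 2) = e ^+ 2 * (4 * x)^-1.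
      by field; rewrite gt_eqF.
    by rewrite gtr_pMr ?exprn_gt0// invf_lt1; lra.
  have -> : f (c *: unit_test k) = c * f (unit_test k) by rewrite linearZ.
  rewrite normrM gtr0_norm// mulrC -ltr_pdivlMr// => /ltW/le_trans; apply.
  by rewrite mul1r /c !invf_div mulrA (mulrC (k.+1%:R ^+ p)) // mulrAC.
have xi_tempered : (fun k => f (unit_test k)) \in @tempered_pred R.
  by apply/asboolP; exists p, C.
exists (Distribution xi_tempered); split.
  (* The partial sums of the pairing are the values of [f] at the truncations of [s], which converge
     to [s] in the test topology. *)
  move=> s; apply/esym/cvg_lim => //.
  have : f (finite_test s n) @[n --> \oo] --> f s.
    by apply: cvg_comp; [exact: finite_test_cvg|exact: fcont].
  by apply: cvg_trans; apply: near_eq_cvg; apply: nearW => n; rewrite f_finite.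
move=> psi fpsi; apply: val_inj; apply/funext => k /=; rewrite fpsi.
apply: cvg_lim => //; apply: cvg_near_cst.
exists k.+1 => // n /= kn; rewrite /series /= (bigD1_seq k) ?iota_uniq ?mem_index_iota//=.
rewrite big1 ?addr0 => [|i /negPf ik]; first by rewrite ltnSn eqxx mul1r.
by rewrite ik if_same mul0r.
Qed.

End RapidSequences.

(** * The triple attached to an orthonormal basis *)

Section HilbertTriple.
Variables (R : realType) (H : normedModType R) (ip : {dot H for idfun}).
Hypothesis hilbert_ip : is_hilbert ip.
Variable e : nat -> H.
Hypothesis orthonormal_e : forall i j, ip (e i) (e j) = (i == j)%:R.
Hypothesis total_e : forall h, (forall n, ip h (e n) = 0) -> h = 0.
Local Notation S := (test_space R).
Local Notation q := (@weighted_norm R).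

Let expansion (s : S) : H := limn (series (fun n => s n *: e n)).

Lemma expansion_cvg (s : S) : cvgn (series (fun n => s n *: e n)).
Proof.
apply: (orthonormal_series_cvg hilbert_ip orthonormal_e).
rewrite (_ : (fun n => _) = fun n => n.+1%:R ^+ 0 * `|s n| ^+ 2).
  exact: weighted_series_cvg.
by apply/funext => n; rewrite expr0 mul1r real_normK ?num_real.
Qed.

Lemma expansion_coef s n : ip (expansion s) (e n) = s n.
Proof.
exact: (orthonormal_series_coef hilbert_ip orthonormal_e _ (@expansion_cvg s)).
Qed.

Lemma coef_inj h k : (forall n, ip h (e n) = ip k (e n)) -> h = k.
Proof.
move=> hk; apply/eqP; rewrite -subr_eq0; apply/eqP/total_e => n.
by rewrite ipBl hk subrr.
Qed.

Lemma expansion_linear : linear expansion.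
Proof. by move=> a s t; apply: coef_inj => n; rewrite ipDl ipZl !expansion_coef. Qed.

Lemma expansion_inj : injective expansion.
Proof.
move=> s t st; apply: val_inj; apply/funext => n.
by rewrite -[LHS]/(s n) -expansion_coef st expansion_coef.
Qed.

(** Parseval: the norm topology seen from the test space is that of [q 0] alone. *)
Lemma expansion_norm s : `|expansion s| = q 0 s.
Proof.
apply/eqP; rewrite -(@eqrXn2 _ 2)// ?weighted_norm_ge0// weighted_normE; apply/eqP.
have /cvg_lim <- // :=
  orthonormal_series_norm hilbert_ip orthonormal_e (@expansion_cvg s).
congr (limn (series _)); apply/funext => n.
by rewrite expr0 mul1r real_normK ?num_real.
Qed.

Lemma expansion_unit k : expansion (unit_test R k) = e k.
Proof.
apply: coef_inj => n.
by rewrite expansion_coef orthonormal_e unit_testE eq_sym.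
Qed.

Lemma expansion_finite a K :
  expansion (finite_test a K) = \sum_(0 <= k < K) a k *: e k.
Proof.
rewrite finite_test_linear; last exact: expansion_linear.
by apply: eq_bigr => k _; rewrite expansion_unit.
Qed.

Lemma expansionB s t : expansion (s - t) = expansion s - expansion t.
Proof. by rewrite addrC -scaleN1r expansion_linear scaleN1r addrC. Qed.

Lemma expansion_continuous : continuous expansion.
Proof.
apply: (@test_linear_continuous R H expansion 1 0); first exact: expansionB.
by move=> s; rewrite expansion_norm mul1r.
Qed.

Lemma expansion_dense : dense (range expansion).
Proof.
move=> O [h Oh] openO.
have /(_ O) := orthonormal_expansion hilbert_ip orthonormal_e total_e (h := h).
case; first exact: open_nbhs_nbhs.
move=> K _ /(_ K (leqnn K)) OK.
exists (series (fun n => ip h (e n) *: e n) K); split => //.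
by exists (finite_test (fun n => ip h (e n)) K) => //; rewrite expansion_finite.
Qed.

(* The q 2-ball is not a pulled back open set: c e_n is small in H uniformly in
   n, while its q 2-norm (n + 1) c is unbounded. *)
Lemma expansion_strictly_finer : strictly_finer expansion.
Proof.
split; first exact: expansion_continuous.
exists [set s | q 2 s < 1].
  rewrite openE => s /= s1; apply/test_nbhsP; exists 2%N, (1 - q 2 s).
  split=> [|t ts]; first by rewrite subr_gt0.
  have := (weighted_norm_seminorm R 2).1 (t - s) s; rewrite subrK.
  by move=> /le_lt_trans; apply; rewrite -ltrBrDr.
move=> U openU UW.
have U0 : U 0.
  have : [set s | q 2 s < 1] 0 by rewrite /= (seminorm0 (weighted_norm_seminorm R 2)).
  rewrite -UW /= -[0 : S](subrr 0) expansionB subrr.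
  by [].
have /nbhs_ballP[r /= r0 rU] : nbhs 0 U by exact: open_nbhs_nbhs.
pose c := r / 2; have c0 : 0 < c by rewrite divr_gt0.
have Wc n : q 2 (c *: unit_test R n) < 1.
  have : [set s | q 2 s < 1] (c *: unit_test R n); last by [].
  rewrite -UW; apply: rU; rewrite -ball_normE /= sub0r normrN expansion_norm.
  rewrite -(ltr_pXn2r (n := 2)) ?nnegrE ?weighted_norm_ge0 ?(ltW r0)//.
  rewrite weighted_norm_unit expr0 mul1r ltr_pXn2r ?nnegrE ?(ltW r0) ?(ltW c0)//.
  by rewrite /c gtr_pMr// invf_lt1// ltr1n.
(* This index satisfies [(n + 1) * c > 1]. *)
have := Wc (Num.trunc c^-1).
apply/negP; rewrite -leNgt -(ler_pXn2r (n := 2)) ?nnegrE ?weighted_norm_ge0//.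
rewrite weighted_norm_unit -exprMn expr1n -[leLHS](expr1n R 2) lerXn2r ?nnegrE//.
  by rewrite mulr_ge0// ltW.
rewrite -ler_pdivrMr// div1r ltW//.
by rewrite truncnS_gt.
Qed.

(* i = \sum_n (n + 1)^-2 ((n + 1)^2 s_n) e_n, with (n + 1)^2 |s_n| <= q 4 s. *)
Lemma expansion_nuclear : nuclear expansion.
Proof.
pose coef n (s : S) : R := n.+1%:R ^+ 2 * s n.
have coef_linear n : scalar (coef n).
  move=> a s t; rewrite /coef (_ : (a *: s + t : S) n = a * s n + t n)//.
  by rewrite mulrDr mulrCA.
pose f n : {scalar S} := HB.pack (coef n) (GRing.isLinear.Build _ _ _ _ _ (coef_linear n)).
exists (fun n => n.+1%:R ^- 2), f, e; split.
- rewrite (_ : series _ = series (fun n => n.+1%:R ^- 2)).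
    exact: inv_square_series_cvg.
  by congr series; apply/funext => n; rewrite ger0_norm// invr_ge0 exprn_ge0.
- move=> s E; rewrite -entourage_ballE => -[eps /= eps0 epsE].
  apply/test_nbhsP; exists 4%N, eps; split => // t ts n _; apply: epsE.
  rewrite /= -ball_normE /= distrC.
  have -> : f n t - f n s = n.+1%:R ^+ 2 * (t - s) n.
    by rewrite -[LHS]/(n.+1%:R ^+ 2 * t n - n.+1%:R ^+ 2 * s n) -mulrBr.
  rewrite normrM ger0_norm ?exprn_ge0//.
  exact: le_lt_trans (weighted_norm_coef 2 _ n) ts.
- by exists 1 => n; rewrite (norm_orthonormal hilbert_ip orthonormal_e).
- move=> s; rewrite (_ : series _ = series (fun n => s n *: e n)).
    exact: expansion_cvg.
  congr series; apply/funext => n; congr (_ *: _).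
  by rewrite -[LHS]/(_ * (_ * _)) mulrA mulVf ?mul1r// expf_neq0.
Qed.

Lemma pairing_coef (s : S) (xi : distribution_space R) h :
  (forall n, xi n = ip h (e n)) -> pairing s xi = ip (expansion s) h.
Proof.
move=> xiE; apply: cvg_lim => //.
pose P := series (fun n => s n *: e n).
have Plim : ip (P n) h @[n --> \oo] --> ip (expansion s) h.
  by apply: (cvg_ipl hilbert_ip); exact: expansion_cvg.
apply: cvg_trans Plim; apply: near_eq_cvg; apply: nearW => n.
by rewrite ip_suml; apply: eq_bigr => k _; rewrite ipZl xiE (ipC ip h).
Qed.

(** An element goes to its coefficient sequence, which is bounded by its norm and hence tempered of
    order 0; totality gives injectivity. *)
Lemma hilbert_embedding : exists2 j : {linear H -> distribution_space R},
  injective j & forall s h, pairing s (j h) = ip (expansion s) h.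
Proof.
have coef_tempered h : (fun n => ip h (e n)) \in @tempered_pred R.
  apply/asboolP; exists 0%N, (`|h| + 1); first by rewrite ltr_wpDl.
  move=> n; rewrite (le_trans (ip_norm_le hilbert_ip _ _))//.
  by rewrite (norm_orthonormal hilbert_ip orthonormal_e) expr0 !mulr1 lerDl.
pose coef h := Distribution (coef_tempered h).
have coef_linear : linear coef.
  by move=> a h k; apply: val_inj; apply/funext => n /=; rewrite ipDl ipZl.
exists (HB.pack coef (GRing.isLinear.Build _ _ _ _ _ coef_linear)
  : {linear H -> distribution_space R}).
  by move=> h k hk; apply: coef_inj => n; have /(congr1 (fun xi => dist_seq xi n)) := hk.
by move=> s h; exact: pairing_coef.
Qed.

Lemma hilbert_gelfand_triple : gelfand_triple ip expansion (@pairing R).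
Proof.
split=> //; first exact: test_frechet.
- by split; [exact: expansion_linear|exact: expansion_inj].
- exact: expansion_dense.
- exact: expansion_strictly_finer.
- exact: expansion_nuclear.
- exact: test_is_dual.
- exact: hilbert_embedding.
Qed.

End HilbertTriple.

(** * The energy space *)

Section EnergySpace.
Variables (R : realType) (V : choiceType) (N : network R V).
Local Notation HE := (energy_space N).
Implicit Types h k : HE.

Lemma energy_class0 : energy_class (0 : finite_energy N) = 0 :> HE.
Proof. exact: raddf0. Qed.

Lemma energy_classB (u v : finite_energy N) :
  energy_class (u - v) = energy_class u - energy_class v :> HE.
Proof. exact: raddfB. Qed.

Lemma increment_linear a h k x y :
  increment (a *: h + k) x y = a * increment h x y + increment k x y.
Proof.
rewrite -(energy_classK h) -(energy_classK k) [a *: _]energy_classZ -energy_classD.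
rewrite !incrementE.
rewrite -[LHS]/(a * repr h x + repr k x - (a * repr h y + repr k y)).
by rewrite mulrBr opprD addrACA.
Qed.

Lemma incrementB h k x y : increment (h - k) x y = increment h x y - increment k x y.
Proof. by rewrite addrC -scaleN1r increment_linear mulN1r addrC. Qed.

Lemma increment_comp h x y z : increment h x z = increment h x y + increment h y z.
Proof. by rewrite /increment addrA subrK. Qed.

Lemma energy_normE h : `|h| ^+ 2 = energy_inner h h.
Proof. by rewrite -[LHS]/(energy_norm h ^+ 2) sqr_sqrtr// energy_inner_ge0. Qed.

Let edge_energy (u : V -> R) (e : V * V) := N e.1 e.2 * (u e.1 - u e.2) ^+ 2.

Let edge_energy_ge0 u e : 0 <= edge_energy u e.
Proof. by rewrite mulr_ge0 ?sqr_ge0// conductance_ge0. Qed.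

Lemma energy_normE_esum (u : finite_energy N) : `|energy_class u| ^+ 2 =
  2^-1 * fine (\esum_(e in [set: V * V]) (N e.1 e.2 * (u e.1 - u e.2) ^+ 2)%:E).
Proof.
rewrite energy_normE energy_innerE /energy; congr (_ * _).
have -> : (fun e : V * V => N e.1 e.2 * (u e.1 - u e.2) * (u e.1 - u e.2)) =
    edge_energy u by apply/funext => e; rewrite -mulrA -expr2.
rewrite ge0_family_sum//.
by have /finite_energyP := finite_energy_funP u.
Qed.

(** The factor 2 undoes the [1/2] of the energy, whose sum runs over ordered pairs. *)
Lemma finite_energy_sum_le h (X : {fset (V * V)}) :
  \sum_(e <- X) N e.1 e.2 * increment h e.1 e.2 ^+ 2 <= 2 * `|h| ^+ 2.
Proof.
rewrite -{2}(energy_classK h) energy_normE_esum mulrA divff ?mul1r//.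
rewrite -lee_fin fineK; last first.
  rewrite ge0_fin_numE ?esum_ge0// => [|e _]; last by rewrite lee_fin edge_energy_ge0.
  exact: (finite_energy_funP (repr h)).
apply: esum_ge; exists [set` X]; first by split => //; exact: finite_fset.
by rewrite fsbig_finite ?finite_fset//= set_fsetK sumEFin.
Qed.

(** Converse of [finite_energy_sum_le]: together they reduce energy estimates to finite edge sums,
    through which pointwise limits pass. *)
Lemma finite_energy_le (u : V -> R) b :
  (forall X : {fset (V * V)}, \sum_(e <- X) N e.1 e.2 * (u e.1 - u e.2) ^+ 2 <= b) ->
  exists2 w : finite_energy N, u = w & `|energy_class w| ^+ 2 <= 2^-1 * b.
Proof.
move=> ub.
have esum_le : (\esum_(e in [set: V * V]) (N e.1 e.2 * (u e.1 - u e.2) ^+ 2)%:E <= b%:E)%E.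
  apply: ge_ereal_sup => _ [X [finX _] <-].
  by rewrite fsbig_finite//= sumEFin lee_fin.
have u_fin : u \in finite_energy_pred N by apply: le_lt_trans esum_le _; rewrite ltry.
exists (FiniteEnergy u_fin) => //; rewrite energy_normE_esum ler_wpM2l//.
rewrite -lee_fin fineK// ge0_fin_numE//.
by apply: esum_ge0 => e _; rewrite lee_fin edge_energy_ge0.
Qed.

(** Telescope along a path from [x] to [y]: an edge of conductance [c] contributes [sqrt (2 / c)] to
    the constant, by the energy of that single edge. *)
Lemma increment_bounded x y :
  exists2 C, 0 <= C & forall h, `|increment h x y| <= C * `|h|.
Proof.
have [p + <-] := conductance_connected N x y.
elim: p x => [x _|z p IH x /= /andP[xz /IH[C C0 hC]]].
  by exists 0 => // h; rewrite /increment subrr normr0 mul0r.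
pose D := Num.sqrt (2 / N x z).
exists (D + C); first by rewrite addr_ge0// sqrtr_ge0.
move=> h; rewrite (increment_comp h x z) mulrDl (le_trans (ler_normD _ _))// lerD//.
rewrite -(ler_pXn2r (n := 2))// ?nnegrE ?mulr_ge0 ?sqrtr_ge0//.
rewrite exprMn sqr_sqrtr ?divr_ge0 ?(ltW xz)// real_normK ?num_real//.
rewrite mulrAC ler_pdivlMr// mulrC.
by have := finite_energy_sum_le h [fset (x, z)]%fset; rewrite big_seq_fset1.
Qed.

(** Stated with functions and finite sums because [l] is not yet known to have finite energy; this
    bound is what will show it. *)
Lemma energy_fatou (F : set_system HE) (l : V -> R) h b (o : V) : ProperFilter F ->
  (forall x, increment k x o @[k --> F] --> l x) -> 0 <= b ->
  (\forall k \near F, `|h - k| <= b) -> forall X : {fset (V * V)},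
  \sum_(e <- X) N e.1 e.2 * ((repr h e.1 - l e.1) - (repr h e.2 - l e.2)) ^+ 2
    <= 2 * b ^+ 2.
Proof.
move=> FF Fl b0 hF X.
have lim_sum : (\sum_(e <- X) N e.1 e.2 * increment (h - k) e.1 e.2 ^+ 2) @[k --> F] -->
    \sum_(e <- X) N e.1 e.2 * ((repr h e.1 - l e.1) - (repr h e.2 - l e.2)) ^+ 2.
  apply: cvg_big => [|e _]; [exact: add_continuous|apply: cvgMr].
  suff c : increment (h - k) e.1 e.2 @[k --> F] -->
      repr h e.1 - l e.1 - (repr h e.2 - l e.2) by rewrite expr2; apply: cvgM.
  have -> : (fun k => increment (h - k) e.1 e.2) = fun k =>
      (repr h e.1 - repr h e.2) - (increment k e.1 o - increment k e.2 o).
    apply/funext => k; rewrite incrementB; congr (_ - _).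
    by rewrite (increment_comp k e.1 e.2 o) addrK.
  have -> : repr h e.1 - l e.1 - (repr h e.2 - l e.2) =
      (repr h e.1 - repr h e.2) - (l e.1 - l e.2) by ring.
  by apply: cvgB; [exact: cvg_cst|apply: cvgB; exact: Fl].
have cst : (fun _ : HE => 2 * b ^+ 2) @ F --> 2 * b ^+ 2 by exact: cvg_cst.
apply: (ler_cvg_to lim_sum cst); apply: filterS hF => k hk.
rewrite (le_trans (finite_energy_sum_le _ _))// ler_wpM2l//.
by rewrite ler_pXn2r ?nnegrE.
Qed.

Lemma energy_complete (o : V) (F : set_system HE) :
  ProperFilter F -> cauchy F -> cvg F.
Proof.
move=> FF /cauchy_ballP cF.
have cauchy_norm e : 0 < e -> \forall h & k \near F, `|h - k| < e.
  by move=> /cF; apply: filterS => -[h k]; rewrite -ball_normE.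
have increment_cvg x : cvg (increment k x o @[k --> F]).
  apply: cauchy_cvg; apply/cauchy_ballP => e e0.
  have [C C0 hC] := increment_bounded x o.
  have d0 : 0 < e / (C + 1) by rewrite divr_gt0// ltr_wpDl.
  have [[A B] /= [FA FB] AB] := cauchy_norm _ d0.
  exists ([set increment k x o | k in A], [set increment k x o | k in B]) => /=.
    split; [apply: filterS FA|apply: filterS FB] => k ?; by exists k.
  move=> [_ _] /= [[h Ah <-] [k Bk <-]]; rewrite -ball_normE /= -incrementB.
  rewrite (le_lt_trans (hC _))//.
  have /= hk := AB (h, k) (conj Ah Bk).
  rewrite (@le_lt_trans _ _ ((C + 1) * `|h - k|))//.
    by rewrite ler_wpM2r// lerDl.
  by rewrite mulrC -ltr_pdivlMr// ltr_wpDl.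
(* The limit function normalised to vanish at [o]. *)
pose l x := lim (increment k x o @[k --> F]).
have lP x : increment k x o @[k --> F] --> l x by exact: increment_cvg.
have near_norm e : 0 < e ->
    \forall h \near F, \forall k \near F, `|h - k| <= e.
  move=> e0; have [[A B] /= [FA FB] AB] := cauchy_norm _ e0.
  apply: filterS FA => h Ah; apply: filterS FB => k Bk.
  exact: ltW (AB (h, k) (conj Ah Bk)).
(* One [h0] within distance 1 of all [k] near [F] is enough: [repr h0 - l] has finite energy, hence
   so has [l]. *)
have [h0 h0P] := filter_ex (near_norm 1 ltr01).
have [w0 w0E _] := finite_energy_le (u := fun x => repr h0 x - l x)
  (energy_fatou FF lP ler01 h0P).
pose L : finite_energy N := repr h0 - w0.
have LE x : L x = l x.
  by rewrite -[L x]/(repr h0 x - w0 x) -w0E subKr.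
apply/cvg_ex; exists (energy_class L); apply/cvgrPdist_le => e e0.
apply: filterS (near_norm e e0) => h hP.
have [w wE wb] := finite_energy_le (u := fun x => repr h x - l x)
  (energy_fatou FF lP (ltW e0) hP).
rewrite distrC -(ler_pXn2r (n := 2))// ?nnegrE ?(ltW e0)//.
have -> : h - energy_class L = energy_class w.
  rewrite -[h in LHS](energy_classK h) -energy_classB; congr energy_class.
  by apply: val_inj; apply/funext => x; rewrite -[RHS]/(w x) -wE -LE.
have e20 : 0 <= e ^+ 2 by rewrite exprn_ge0// ltW.
by rewrite (le_trans wb)// mulrA mulVf// mul1r.
Qed.

Lemma energy_hilbert (o : V) : is_hilbert (@energy_inner R V N).
Proof. by split; [exact: energy_normE|exact: energy_complete]. Qed.

(** [get] meets its specification only if the set is inhabited; Riesz, applied to the bounded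
    increment functional, supplies the element. *)
Lemma energy_kernelP (o x : V) h :
  energy_inner (energy_kernel N o x) h = increment h x o.
Proof.
have [C C0 hC] := increment_bounded x o.
have inc_linear : scalar (fun h : HE => increment h x o).
  by move=> a k1 k2; rewrite increment_linear.
pose f : {scalar HE} := HB.pack (fun h : HE => increment h x o)
  (GRing.isLinear.Build _ _ _ _ _ inc_linear).
have [v vP] := riesz (energy_hilbert o) (f := f) hC.
by have := @getPex _ [set v : HE | forall u, energy_inner v u = increment u x o]
  (ex_intro _ v vP); exact.
Qed.

(** Only edges leaving or entering [x] contribute, and either kind sums to [c(x)]; swapping the
    endpoints carries one kind to the other. *)
Lemma delta_finite_energy x : (fun y => (y == x)%:R : R) \in finite_energy_pred N.
Proof.
apply/finite_energyP.
have out : fsummable (fun e : V * V => if e.1 == x then N x e.2 else 0%R).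
  rewrite /fsummable /summable.
  have -> : (\esum_(e in [set: V * V]) `|(EFin \o
        (fun e => if e.1 == x then N x e.2 else 0%R)) e|)%E =
      (\esum_(y in [set: V]) (N x y)%:E)%E.
    rewrite -(@reindex_esum _ _ _ setT [set e | e.1 = x] (fun y => (x, y))
        (fun e => (N x e.2)%:E)); last first.
      split=> [y _|y z _ _ [->]//|[a b] /= ->]//; by exists b.
    rewrite [RHS]esum_mkcond; apply: eq_esum => e _ /=.
    case: eqP => [ex|/eqP ex]; first by rewrite mem_set//= ger0_norm// conductance_ge0.
    by rewrite memNset ?normr0//= => /eqP; apply/negP.
  exact: conductance_summable.
have inn : fsummable (fun e : V * V => if e.2 == x then N x e.1 else 0%R).
  rewrite /fsummable /summable (@reindex_esum _ _ _ setT setT (fun e => (e.2, e.1))).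
    exact: out.
  by split=> [//|[a b] [c d] _ _ [-> ->]//|[a b] _]; exists (b, a).
apply: le_fsummable (fsummableD out inn) => -[a b] /=.
rewrite normrM ger0_norm ?conductance_ge0//.
have N0 := conductance_ge0 N.
case: eqP => [->|_]; case: eqP => [->|_].
- by rewrite subrr expr0n normr0 mulr0 addr_ge0.
- by rewrite subr0 expr1n normr1 mulr1 addr0.
- by rewrite sub0r sqrrN expr1n normr1 mulr1 add0r conductance_sym.
- by rewrite subrr expr0n normr0 mulr0 addr0.
Qed.

Definition energy_delta x : HE := energy_class (FiniteEnergy (delta_finite_energy x)).

Lemma increment_delta x y z : increment (energy_delta x) y z = (y == x)%:R - (z == x)%:R.
Proof. exact: incrementE. Qed.

Lemma increment0_eq0 (o : V) h : (forall x, increment h x o = 0) -> h = 0.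
Proof.
move=> h0; rewrite -(energy_classK h) -energy_class0; apply/energy_class_eq.
by exists (repr h o) => x; rewrite subr0; apply/eqP; rewrite -subr_eq0 -/(increment h x o) h0.
Qed.

(** * Kernels, point masses and the energy basis *)

Section Enumeration.
Variables (o : V) (x : nat -> V).
Hypothesis x_enum : set_bij [set: nat] [set~ o] x.

(** The reproducing property evaluates the point mass at [x n] and at [o], and the enumeration is
    injective and avoids [o]. *)
Lemma energy_kernel_delta n m :
  energy_inner (energy_kernel N o (x n)) (energy_delta (x m)) = (n == m)%:R.
Proof.
have [xo xinj _] := x_enum.
rewrite energy_kernelP increment_delta.
have /negPf -> : o != x m by rewrite eq_sym; apply/eqP; exact: (xo m I).
by rewrite subr0 (inj_in_eq xinj) ?in_setT.
Qed.

Lemma energy_basis_orthonormal i j :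
  energy_inner (energy_basis N o x i) (energy_basis N o x j) = (i == j)%:R.
Proof. exact: gram_schmidt_orthonormal energy_kernel_delta i j. Qed.

Lemma energy_basis_total h :
  (forall n, energy_inner h (energy_basis N o x n) = 0) -> h = 0.
Proof.
move=> hb; have [_ _ xsurj] := x_enum.
apply: (@increment0_eq0 o) => y; have [->|yo] := eqVneq y o.
  by rewrite /increment subrr.
have [n _ <-] := xsurj y (elimN eqP yo).
rewrite -energy_kernelP energy_inner_sym.
exact: (gram_schmidt_total energy_kernel_delta hb).
Qed.

End Enumeration.
End EnergySpace.

Theorem corollary3p10 (R : realType) (V : choiceType) (N : network R V)
    (V_infinite : infinite_set [set: V])
    (o : V) (x : nat -> V) (x_enum : set_bij [set: nat] [set~ o] x) :
  nuclear (test_inclusion N o x) /\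
  gelfand_triple (@energy_inner R V N) (test_inclusion N o x) (@pairing R).
Proof.
have triple := hilbert_gelfand_triple (energy_hilbert N o)
  (energy_basis_orthonormal N x_enum) (@energy_basis_total R V N o x x_enum).
by split; [exact: gelfand_nuclear triple|exact: triple].
Qed.
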